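(* Consider the heteroscedastic normal mixture model with $\beta=1$: $P_{n,i}=P_0=N(0,1)$, $\mu_{n,i}=\mu_n=N(\vartheta_n,\sigma_0^2)$, $\varepsilon_{n,i}=\varepsilon_n=n^{-1}$, $1\le i\le n$, where $\sigma_0>0$, $\vartheta_n=\sqrt{2r\log n}$ and $r>0$. Let $Q_n=(1-\varepsilon_n)P_0+\varepsilon_n\mu_n$, $P_{(n)}=P_0^{\otimes n}$, $Q_{(n)}=Q_n^{\otimes n}$, and $T_n=\sum_{i=1}^n\log\frac{dQ_n}{dP_0}(Y_{n,i})$ with $Y_{n,i}$ the coordinates. (i) If $r<1$, then the undetectable case is present. (ii) If $r=1$, then $T_n$ converges in distribution to $\xi_1$ under $P_{(n)}$ and to $\xi_2$ under $Q_{(n)}$, where $\xi_1\equiv-1/2$ and $\xi_2\sim e^{-1/2}\epsilon_{-1/2}+(1-e^{-1/2})\epsilon_\infty$. (iii) If $r>1$, then $T_n$ converges in distribution to $\xi_1$ under $P_{(n)}$ and to $\xi_2$ under $Q_{(n)}$, where $\xi_1\equiv-1$ and $\xi_2\sim e^{-1}\epsilon_{-1}+(1-e^{-1})\epsilon_\infty$.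
   Context: $\epsilon_a$ denotes the Dirac measure at $a\in[-\infty,\infty]$; convergence in distribution is on $[-\infty,\infty]$. Undetectable case: for every sequence of tests $\psi_n$ (measurable functions of the observations with values in $[0,1]$), $E_{P_{(n)}}(\psi_n)+E_{Q_{(n)}}(1-\psi_n)\to1$. *)

(* Defs.v *)
From HB Require Import structures.
From mathcomp Require Import all_boot all_order all_algebra.
From mathcomp Require Import all_classical all_reals all_analysis measurable_realfun.

Set Implicit Arguments.
Unset Strict Implicit.
Unset Printing Implicit Defensive.

Import Order.TTheory GRing.Theory Num.Theory.
Import numFieldTopology.Exports numFieldNormedType.Exports.

Local Open Scope classical_set_scope.
Local Open Scope charge_scope.
Local Open Scope ring_scope.

(* The mixture p P + (1 - p) Q.  As for [bernoulli_prob], a value of p outside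
   [0, 1] is meaningless and is sent to a default probability. *)
Definition mixture d (T : measurableType d) (R : realType) (p : R)
    (P Q : probability T R) : set T -> \bar R :=
  fun A => if 0 <= p <= 1 then (p%:E * P A + (1 - p)%:E * Q A)%E else Q A.

Section mixture_probability.
Context d (T : measurableType d) (R : realType) (p : R) (P Q : probability T R).
Local Notation mix := (mixture p P Q).

Let mixture0 : mix set0 = 0%E.
Proof. by rewrite /mixture !measure0 !mule0 adde0; case: ifP. Qed.

Let mixture_ge0 A : (0 <= mix A)%E.
Proof.
rewrite /mixture; case: ifPn => // /andP[p0 p1].
by rewrite adde_ge0// mule_ge0// lee_fin ?subr_ge0.
Qed.

Let mixture_sigma_additive : semi_sigma_additive mix.
Proof.
have [/[dup] p01 /andP[p0 p1]|/negbTE np01] := boolP (0 <= p <= 1); last first.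
  rewrite (_ : mix = Q); first exact: measure_semi_sigma_additive.
  by apply/funext => A; rewrite /mixture np01.
have q0 : 0 <= 1 - p by rewrite subr_ge0.
rewrite (_ : mix =
    measure_add (mscale (NngNum p0) P) (mscale (NngNum q0) Q)).
  exact: measure_semi_sigma_additive.
by apply/funext => A; rewrite /mixture p01 measure_addE.
Qed.

HB.instance Definition _ := isMeasure.Build _ _ _ mix
  mixture0 mixture_ge0 mixture_sigma_additive.

Let mixture_setT : mix setT = 1%E.
Proof.
rewrite /mixture !probability_setT !mule1; case: ifP => // _.
by rewrite -EFinD addrC subrK.
Qed.

HB.instance Definition _ :=
  Measure_isProbability.Build _ _ _ mix mixture_setT.

End mixture_probability.

Section iid.
Context d (T : measurableType d) (R : realType).

Definition tuple_cons n (x : T * n.-tuple T) : n.+1.-tuple T :=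
  [the n.+1.-tuple T of x.1 :: x.2].

Lemma measurable_tuple_cons n : measurable_fun setT (@tuple_cons n).
Proof. exact: measurable_cons measurable_fst measurable_snd. Qed.

HB.instance Definition _ n :=
  isMeasurableFun.Build _ _ _ _ (@tuple_cons n) (@measurable_tuple_cons n).

(* The product measure of n copies of P. *)
Fixpoint iid (P : probability T R) n : probability (n.-tuple T) R :=
  match n with
  | 0%N => \d_[tuple]
  | m.+1 => distribution (P \x iid P m)%E (@tuple_cons m)
  end.

Lemma iid_rectangle (P : probability T R) n (A : 'I_n -> set T) :
  (forall i, measurable (A i)) ->
  iid P n [set y | forall i, A i (tnth y i)] = (\prod_(i < n) P (A i))%E.
Proof.
elim: n A => [|n IH] A mA.
  rewrite big_ord0 /= diracE mem_set//= => i.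
  by have := ltn_ord i; rewrite ltn0.
rewrite big_ord_recl -IH//= /distribution /pushforward.
rewrite -product_measure1E//; last first.
  rewrite [X in measurable X](_ : _ =
    \big[setI/setT]_(i < n) ((@tnth n T ^~ i) @^-1` A (lift ord0 i))).
    apply: bigsetI_measurable => i _.
    by rewrite -[X in measurable X]setTI; exact: measurable_tnth.
  apply/seteqP; split => [y /= Ay|y].
    elim/big_ind : _ => // i _; exact: Ay.
  by rewrite -bigcap_seq => /= Ay i; apply: Ay; rewrite /= mem_index_enum.
congr (_ _); apply/seteqP; split => [[x y] /= Axy|[x y] /= [Ax Ay] i].
  split; first by have := Axy ord0; rewrite tnth0.
  by move=> i; have := Axy (lift ord0 i); rewrite tnthS.
by case: (unliftP ord0 i) => [j ->|->]; rewrite ?tnthS ?tnth0.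
Qed.

End iid.

Lemma measurable_lne (R : realType) : measurable_fun [set: \bar R] (@lne R).
Proof.
rewrite (_ : @lne R = fun x => if (x <= 0)%E then -oo%E else er_map (@ln R) x).
  apply: measurable_fun_ifT => //=; last first.
    by apply: (@measurable_er_map _ unit); exact: measurable_ln.
  apply: measurable_fun_lee; [exact: measurable_id|exact: measurable_cst].
by apply/funext => -[x||] //; rewrite ?leNye ?leye_eq //= lee_fin.
Qed.

Section log_likelihood.
Context d (T : measurableType d) (R : realType) (P Q : probability T R).

(* Meaningful for Q `<< P, where the library's derivative is a genuine density;
   otherwise that derivative is the constant -oo. *)
Definition log_likelihood n (y : n.-tuple T) : \bar R :=
  (\sum_(i < n) lne (('d (charge_of_finite_measure Q) '/d P) (tnth y i)))%E.

Let measurable_log_likelihood n : measurable_fun setT (@log_likelihood n).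
Proof.
apply: emeasurable_sum => i; apply: measurableT_comp; first exact: measurable_lne.
apply: (measurableT_comp _ (@measurable_tnth _ _ _ _)).
have [QP|QP] := pselect (charge_of_finite_measure Q `<< P).
  exact: measurable_int (Radon_Nikodym_integrable _).
rewrite /Radon_Nikodym; case: pselect => // _; exact: measurable_cst.
Qed.

HB.instance Definition _ n :=
  isMeasurableFun.Build _ _ _ _ (@log_likelihood n)
    (@measurable_log_likelihood n).

End log_likelihood.

(* Weak convergence of laws on the compactified line [-oo, +oo]; [\bar R]
   carries the usual topology in which +oo and -oo have bases of neighbourhoods
   ]M, +oo] and [-oo, M[. *)
Definition weakly_converges (R : realType) (nu_ : nat -> probability (\bar R) R)
    (nu : probability (\bar R) R) : Prop :=
  forall f : \bar R -> R, continuous f -> (exists M, forall x, `|f x| <= M) ->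
    ('E_(nu_ n)[f])%E @[n --> \oo] --> ('E_nu[f])%E.

Definition undetectable (R : realType) (d : nat -> measure_display)
    (T : forall n, measurableType (d n)) (P Q : forall n, probability (T n) R)
    : Prop :=
  forall psi : forall n, {mfun T n >-> R}, (forall n y, 0 <= psi n y <= 1) ->
    ('E_(P n)[psi n] + 'E_(Q n)[fun y => (1 - psi n y)%R])%E @[n --> \oo] --> 1%E.

Section normal_mixture.
Context (R : realType).

(* The second parameter of [normal_prob] is the standard deviation. *)
Definition P0 : probability (measurableTypeR R) R := normal_prob 0 1.

Variables (sigma0 r : R) (n : nat).

Definition eps : R := n%:R^-1.

Definition theta : R := Num.sqrt (2 * r * ln n%:R).

Definition mun : probability (measurableTypeR R) R := normal_prob theta sigma0.

(* (1 - eps) P0 + eps mun *)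
Definition Qn : probability (measurableTypeR R) R := mixture eps mun P0.

Definition prodP : probability (n.-tuple (measurableTypeR R)) R := iid P0 n.

Definition prodQ : probability (n.-tuple (measurableTypeR R)) R := iid Qn n.

Definition Tn : {mfun n.-tuple (measurableTypeR R) >-> \bar R} :=
  @log_likelihood _ _ _ P0 Qn n.

End normal_mixture.
Arguments P0 : clear implicits.
Arguments eps : clear implicits.
Arguments prodP : clear implicits.

(* Main.v *)
(** Let L be the likelihood ratio of Q_(n) against P_(n), f the density of mu_n
    against P_0 and h = f / n.  Truncate each factor of L to the set
    A = {h <= 1}.  The truncated product U has first and second moments
    (1 + x_n / n)^n and (1 + y_n / n)^n, where x_n --> p - 1 and
    y_n --> 2 (p - 1) as soon as mu_n A --> p and the mean of min(h, 1/h) under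
    mu_n tends to 0; the latter also bounds n P_0(~A), so that U = L with
    probability tending to 1.  Hence L --> l = exp(p - 1) in P_(n)-probability.
    As L has mean 1, the missing mass 1 - l has escaped to +oo under Q_(n), which
    gives both limit laws of log L.  Under mu_n, with x = theta_n + sigma_0 z and
    z standard normal, log h is a quadratic polynomial in theta_n with leading
    coefficient (r - 1) / (2 r) and linear coefficient sigma_0 z; so p is 1, 1/2
    or 0 according as r < 1, r = 1 or r > 1. *)
Require Import Defs.
From mathcomp Require Import ring lra.
From mathcomp Require Import all_boot all_order all_algebra.
From mathcomp Require Import all_classical all_reals all_analysis measurable_realfun.
Set Implicit Arguments.
Unset Strict Implicit.
Unset Printing Implicit Defensive.
Import Order.TTheory GRing.Theory Num.Theory.
Import numFieldTopology.Exports numFieldNormedType.Exports.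
Local Open Scope classical_set_scope.
Local Open Scope ring_scope.

(** * Integration against densities and mixtures *)

Section integrals.
Context d (T : measurableType d) (R : realType).
Local Open Scope ereal_scope.

(** The library's change of variables is about its own derivative of [nu]. That derivative and [g]
    have the same integral over every measurable set, so they agree [mu]-almost everywhere and [g]
    may take its place. *)
Lemma ge0_integral_density (nu : {finite_measure set T -> \bar R})
    (mu : {sigma_finite_measure set T -> \bar R}) (g : T -> R)
    (phi : T -> \bar R) :
  measurable_fun setT g -> (forall x, 0 <= g x)%R ->
  (forall A, measurable A -> nu A = \int[mu]_(x in A) (g x)%:E) ->
  measurable_fun setT phi -> (forall x, 0 <= phi x) ->
  \int[nu]_x phi x = \int[mu]_x (phi x * (g x)%:E).
Proof.
move=> mg g0 nuE mphi phi0.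
have mg' : measurable_fun setT (EFin \o g) by exact/measurable_EFinP.
have numu : nu `<< mu.
  apply/null_content_dominatesP => A mA A0.
  by rewrite nuE// null_set_integral//; exact: measurable_funTS.
rewrite -(@Radon_Nikodym_SigmaFinite.change_of_variables _ _ _ nu mu)//.
have mf : measurable_fun setT (Radon_Nikodym_SigmaFinite.f nu mu).
  exact: measurable_int (Radon_Nikodym_SigmaFinite.f_integrable numu).
apply: ge0_ae_eq_integral => //.
- exact: emeasurable_funM.
- exact: emeasurable_funM.
- by move=> x _; rewrite mule_ge0 ?Radon_Nikodym_SigmaFinite.f_ge0.
- by move=> x _; rewrite mule_ge0 ?lee_fin.
- apply: ae_eqe_mul2l; apply: integral_ae_eq => //.
    exact: Radon_Nikodym_SigmaFinite.f_integrable.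
  move=> A _ mA.
  by rewrite -Radon_Nikodym_SigmaFinite.f_integral// nuE.
Qed.

Lemma ge0_integral_mixture (p : R) (P Q : probability T R) (phi : T -> \bar R) :
  (0 <= p <= 1)%R -> measurable_fun setT phi -> (forall x, 0 <= phi x) ->
  \int[mixture p P Q]_x phi x =
  p%:E * \int[P]_x phi x + (1 - p)%:E * \int[Q]_x phi x.
Proof.
move=> p01 mphi phi0; have /andP[p0 p1] := p01.
have q0 : (0 <= 1 - p)%R by rewrite subr_ge0.
rewrite (eq_measure_integral (measure_add (mscale (NngNum p0) P)
    (mscale (NngNum q0) Q))); last first.
  move=> A mA _; rewrite [RHS]measure_addE -[LHS]/(mixture p P Q A).
  by rewrite /mixture p01.
by rewrite ge0_integral_measure_add// !ge0_integral_mscale.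
Qed.

End integrals.

(** * Integration over independent samples *)

Section iid_integrals.
Context d (T : measurableType d) (R : realType).
Local Open Scope ereal_scope.

Lemma measurable_prod_tnth n (w : T -> R) : measurable_fun setT w ->
  measurable_fun setT (fun y : n.-tuple T => \prod_(i < n) w (tnth y i))%R.
Proof.
move=> mw; apply: measurable_prod => i _.
exact: (measurableT_comp mw (@measurable_tnth _ _ _ _)).
Qed.

Lemma ge0_integral_iidS (P : probability T R) n
    (phi : n.+1.-tuple T -> \bar R) :
  measurable_fun setT phi -> (forall y, 0 <= phi y) ->
  \int[iid P n.+1]_y phi y =
  \int[P]_x \int[iid P n]_y phi (tuple_cons (x, y)).
Proof.
move=> mphi phi0; rewrite /= ge0_integral_distribution//.
rewrite fubini_tonelli1//.
  exact: (measurableT_comp mphi (@measurable_tuple_cons _ _ _)).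
by move=> z; exact: phi0.
Qed.

Lemma integral_iid0 (P : probability T R) (phi : 0.-tuple T -> \bar R) :
  measurable_fun setT phi -> \int[iid P 0]_y phi y = phi [tuple].
Proof. by move=> mphi; rewrite /= integral_dirac// diracT mul1e. Qed.

Lemma prod_tuple_cons n (w : T -> R) x (y : n.-tuple T) :
  (\prod_(i < n.+1) w (tnth (tuple_cons (x, y)) i) =
   w x * \prod_(i < n) w (tnth y i))%R.
Proof.
rewrite big_ord_recl tnth0; congr *%R.
by apply: eq_bigr => i _; rewrite tnthS.
Qed.

(** Independence in integral form: Tonelli splits off one coordinate at a time, which turns moments
    of product statistics into powers of one-dimensional integrals. *)
Lemma integral_iid_prod (P : probability T R) n (w : T -> R) :
  measurable_fun setT w -> (forall x, 0 <= w x)%R ->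
  \int[iid P n]_y (\prod_(i < n) w (tnth y i))%:E =
  (\int[P]_x (w x)%:E) ^+ n.
Proof.
move=> mw w0.
have mw' : measurable_fun setT (EFin \o w) by exact/measurable_EFinP.
have mprod k : measurable_fun setT
    (fun y : k.-tuple T => (\prod_(i < k) w (tnth y i))%:E).
  by apply/measurable_EFinP; exact: measurable_prod_tnth.
have prod0 k (y : k.-tuple T) : 0 <= (\prod_(i < k) w (tnth y i))%:E.
  by rewrite lee_fin prodr_ge0.
elim: n => [|n IH]; first by rewrite integral_iid0// big_ord0.
rewrite ge0_integral_iidS// expeS.
transitivity (\int[P]_x ((w x)%:E * (\int[P]_x (w x)%:E) ^+ n)).
  apply: eq_integral => x _; under eq_integral do rewrite prod_tuple_cons EFinM.
  rewrite ge0_integralZl ?lee_fin//; last exact: mprod.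
  by congr (_ * _); exact: IH.
rewrite ge0_integralZr//; first by move=> x _; rewrite lee_fin.
by apply: expe_ge0; apply: integral_ge0 => x _; rewrite lee_fin.
Qed.

(** Moves an expectation from the alternative to the null at the price of the likelihood ratio. By
    induction: the inner integral changes measure by hypothesis, the first coordinate by
    [ge0_integral_density]. *)
Lemma ge0_integral_iid_density (P Q : probability T R) (g : T -> R) n
    (phi : n.-tuple T -> \bar R) :
  measurable_fun setT g -> (forall x, 0 <= g x)%R ->
  (forall A, measurable A -> Q A = \int[P]_(x in A) (g x)%:E) ->
  measurable_fun setT phi -> (forall y, 0 <= phi y) ->
  \int[iid Q n]_y phi y =
  \int[iid P n]_y (phi y * (\prod_(i < n) g (tnth y i))%:E).
Proof.
move=> mg g0 QE.
have mg' : measurable_fun setT (EFin \o g) by exact/measurable_EFinP.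
have mprod k : measurable_fun setT
    (fun y : k.-tuple T => (\prod_(i < k) g (tnth y i))%:E).
  by apply/measurable_EFinP; exact: measurable_prod_tnth.
have prod0 k (y : k.-tuple T) : 0 <= (\prod_(i < k) g (tnth y i))%:E.
  by rewrite lee_fin prodr_ge0.
elim: n phi => [|n IH] phi mphi phi0.
  rewrite !integral_iid0 ?big_ord0 ?mule1//.
  exact: (emeasurable_funM mphi (mprod _)).
rewrite !ge0_integral_iidS//; last 2 first.
- exact: (emeasurable_funM mphi (mprod _)).
- by move=> y; rewrite mule_ge0.
have mphi' : measurable_fun setT (fun z => phi (tuple_cons (n:=n) z)).
  exact: (measurableT_comp mphi (@measurable_tuple_cons _ _ _)).
under eq_integral => x _.
  rewrite IH//; last exact: (measurableT_comp mphi' (measurable_pair1 x)).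
  over.
rewrite (@ge0_integral_density _ _ _ Q P g)//; last 2 first.
- apply: (@measurable_fun_fubini_tonelli_F _ _ _ _ _ (iid P n)
    (fun z => phi (tuple_cons z) * (\prod_(i < n) g (tnth z.2 i))%:E)).
  + apply: emeasurable_funM => //.
    exact: (measurableT_comp (mprod n) measurable_snd).
  + by move=> z; rewrite mule_ge0.
- by move=> x; apply: integral_ge0 => y _; rewrite mule_ge0.
apply: eq_integral => x _.
rewrite -ge0_integralZr ?lee_fin//; last 2 first.
- apply: emeasurable_funM; last exact: mprod.
  exact: (measurableT_comp mphi' (measurable_pair1 x)).
- by move=> y _; rewrite mule_ge0.
by apply: eq_integral => y _; rewrite prod_tuple_cons EFinM muleA muleAC -muleA.
Qed.

End iid_integrals.

(** * Expectations of asymptotically linear functions of the likelihood ratio *)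

Section truncated_convergence.
Context (R : realType).
Local Open Scope ereal_scope.

(** Nonnegative coefficients and functions make every integral meaningful in the extended reals.
    Later estimates are therefore arranged with each term on the side where its sign is positive. *)
Lemma integral_affine d (T : measurableType d) (P : probability T R)
    (c0 c1 c2 : R) (f1 f2 : T -> R) :
  (0 <= c0)%R -> (0 <= c1)%R -> (0 <= c2)%R ->
  measurable_fun setT f1 -> measurable_fun setT f2 ->
  (forall x, 0 <= f1 x)%R -> (forall x, 0 <= f2 x)%R ->
  \int[P]_x (c0 + c1 * f1 x + c2 * f2 x)%:E =
  c0%:E + c1%:E * \int[P]_x (f1 x)%:E + c2%:E * \int[P]_x (f2 x)%:E.
Proof.
move=> c00 c10 c20 mf1 mf2 f10 f20.
have mf1' : measurable_fun setT (EFin \o f1) by exact/measurable_EFinP.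
have mf2' : measurable_fun setT (EFin \o f2) by exact/measurable_EFinP.
under eq_integral do rewrite 2!EFinD 2!EFinM.
rewrite ge0_integralD//; last 4 first.
- by move=> x _; rewrite -EFinM -EFinD lee_fin addr_ge0// mulr_ge0.
- by apply: emeasurable_funD => //; exact: measurable_funeM.
- by move=> x _; rewrite -EFinM lee_fin mulr_ge0.
- exact: measurable_funeM.
rewrite ge0_integralD//; last 2 first.
- by move=> x _; rewrite -EFinM lee_fin mulr_ge0.
- exact: measurable_funeM.
rewrite integral_cst// [X in _ * X + _ + _]probability_setT mule1.
by rewrite !ge0_integralZl ?lee_fin// => x _; rewrite lee_fin.
Qed.

(* The subtraction of the linear part [a x] is exact because [L_ n] has mean 1;
   what remains is sublinear and is controlled by convergence in probability. *)
Lemma cvg_integral_comp (d : nat -> measure_display)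
    (T : forall n, measurableType (d n)) (P : forall n, probability (T n) R)
    (L : forall n, T n -> R) (t : R^nat) (l a : R) (phi : R -> R) :
  (forall n, measurable_fun setT (L n)) -> (forall n y, 0 <= L n y)%R ->
  (forall n, \int[P n]_y (L n y)%:E = 1) ->
  (forall n, \int[P n]_y (Num.min 1 ((L n y - l) ^+ 2))%:E <= (t n)%:E) ->
  t n @[n --> \oo] --> (0 : R)%R -> (0 <= l)%R -> (0 <= a)%R ->
  measurable_fun setT phi -> (forall x, 0 <= phi x)%R ->
  {for l, continuous phi} ->
  (forall e : R, 0 < e -> exists K : R, forall x : R, 0 <= x ->
    `|phi x - a * x| <= K + e * x)%R ->
  \int[P n]_y (phi (L n y))%:E @[n --> \oo] --> (phi l + a * (1 - l))%:E.
Proof.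
move=> mL L0 L1 Lt t0 l0 a0 mphi phi0 cphi asym.
pose m n y := Num.min 1%R ((L n y - l) ^+ 2)%R.
have m0 n y : (0 <= m n y)%R by rewrite le_min ler01 sqr_ge0.
have mm n : measurable_fun setT (m n).
  apply: measurable_minr; first exact: measurable_cst.
  by apply: measurable_funX; exact: measurable_funB.
have mphiL n : measurable_fun setT (fun y => phi (L n y)).
  exact: measurableT_comp (mphi) (mL n).
have maff n c0 c1 c2 (f1 f2 : T n -> R) :
    measurable_fun setT f1 -> measurable_fun setT f2 ->
    measurable_fun setT (fun y => (c0 + c1 * f1 y + c2 * f2 y)%:E).
  move=> mf1 mf2; apply/measurable_EFinP; apply: measurable_funD.
    by apply: measurable_funD => //; exact: measurable_funM.
  exact: measurable_funM.
(* Within distance [r] of [l], continuity gives the bound [e]. Beyond it the truncated square is at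
   least [q = min(1, r^2)], so a constant [C] with denominator [q] absorbs [K + |phi l - a l|]. *)
have main (e : R) : (0 < e)%R ->
    exists2 C : R, (0 <= C)%R & forall x : R, (0 <= x)%R ->
    (`|(phi x + a * l) - (phi l + a * x)| <=
      e + e * x + C * Num.min 1 ((x - l) ^+ 2))%R.
  move=> e0; have [K HK] := asym _ e0.
  have cont : {for l, continuous (fun x => phi x - a * x)%R}.
    apply: (@cvgB _ R^o _ _ _ phi) => //.
    apply: (@cvgM R _ _ _ (cst a)); [exact: cvg_cst|exact: cvg_id].
  have /cvgrPdist_le/(_ _ e0) := cont.
  move=> /nbhs_ballP[r /= r0 Hr].
  pose q := Num.min 1%R (r ^+ 2)%R.
  have q0 : (0 < q)%R by rewrite lt_min ltr01 exprn_gt0.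
  have K0 : (0 <= K)%R.
    by have := HK 0%R (lexx _); rewrite !mulr0 addr0; apply: le_trans.
  exists ((K + `|phi l - a * l|) / q)%R.
    by rewrite divr_ge0 ?addr_ge0// ltW.
  move=> x x0.
  have -> : (phi x + a * l - (phi l + a * x) =
    (phi x - a * x) - (phi l - a * l))%R by ring.
  have M0 : (0 <= Num.min 1 ((x - l) ^+ 2))%R by rewrite le_min ler01 sqr_ge0.
  have C0 : (0 <= (K + `|phi l - a * l|) / q)%R.
    by rewrite divr_ge0 ?addr_ge0// ltW.
  have [xr|xr] := ltP `|l - x|%R r.
    have := Hr x xr; rewrite /= distrC => /le_trans; apply.
    by rewrite -addrA lerDl addr_ge0// mulr_ge0// ltW.
  have qM : (q <= Num.min 1 ((x - l) ^+ 2))%R.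
    rewrite /q le_min ge_min lexx/= ge_min; apply/orP; right.
    by rewrite -[leRHS]real_normK ?num_real// distrC ler_pXn2r ?nnegrE ?(ltW r0).
  have H1 : (K + `|phi l - a * l| <=
      (K + `|phi l - a * l|) / q * Num.min 1 ((x - l) ^+ 2))%R.
    by rewrite mulrAC ler_pdivlMr// ler_wpM2l// addr_ge0.
  have H2 := HK x x0; have := ler_normB (phi x - a * x)%R (phi l - a * l)%R.
  by lra.
pose I n := \int[P n]_y (phi (L n y))%:E.
have I0 n : 0 <= I n by apply: integral_ge0 => y _; rewrite lee_fin.
pose M n := \int[P n]_y (m n y)%:E.
have M0 n : 0 <= M n by apply: integral_ge0 => y _; rewrite lee_fin.
have Mfin n : M n \is a fin_num.
  by rewrite ge0_fin_numE// (le_lt_trans (Lt n))// ltry.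
(* The two sides of the absolute value in [main], integrated separately; [L n] has mean 1, so [a x]
   and [e x] contribute [a] and [e]. *)
have up (e C : R) n : (0 < e)%R -> (0 <= C)%R -> (forall x : R, (0 <= x)%R ->
    (`|(phi x + a * l) - (phi l + a * x)| <=
      e + e * x + C * Num.min 1 ((x - l) ^+ 2))%R) ->
    (a * l)%:E + I n <= (phi l + a + e + e)%:E + C%:E * M n /\
    (phi l + a)%:E <= (a * l + e + e)%:E + I n + C%:E * M n.
  move=> e0 C0 H; split.
    have := @integral_affine _ _ (P n) (a * l)%R 1 0 (phi \o L n) (m n)
      (mulr_ge0 a0 l0) ler01 (lexx _) (mphiL n) (mm n)
      (fun y => phi0 _) (m0 n).
    rewrite mul1e mul0e adde0 => <-.
    have := @integral_affine _ _ (P n) (phi l + e)%R (a + e)%R C (L n) (m n)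
      _ _ C0 (mL n) (mm n) (L0 n) (m0 n).
    rewrite L1 mule1 -EFinD => /(_ (addr_ge0 (phi0 _) (ltW e0))
      (addr_ge0 a0 (ltW e0))).
    rewrite addrACA -!addrA => <-.
    apply: ge0_le_integral => //.
    - by move=> y _; rewrite lee_fin mul1r mul0r addr0 /= addr_ge0 ?mulr_ge0.
    - exact: maff.
    - exact: maff.
    - move=> y _; rewrite lee_fin mul1r mul0r addr0 /=.
      by have := H (L n y) (L0 n y); rewrite ler_norml /m => /andP[_]; lra.
  have := @integral_affine _ _ (P n) (phi l)%R a 0 (L n) (m n)
      (phi0 _) a0 (lexx _) (mL n) (mm n) (L0 n) (m0 n).
  rewrite L1 mule1 mul0e adde0 -EFinD => <-.
  (* Three functions of [y] occur, while [integral_affine] takes two; the integral is split and zero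
     coefficients fill the empty places. *)
  have E1 : (a * l + e + e)%:E + I n + C%:E * M n =
    \int[P n]_y (a * l + e + 1 * phi (L n y) + 0 * m n y)%:E +
    \int[P n]_y (0 + e * L n y + C * m n y)%:E.
    rewrite !integral_affine ?addr_ge0 ?mulr_ge0 ?(ltW e0)//.
    rewrite L1 mule1 mul1e mul0e adde0 add0e EFinD.
    by rewrite -/(I n) -/(M n) [RHS]addeA [X in _ = X + _]addeAC.
  rewrite E1 -ge0_integralD//; last 4 first.
  - by move=> y _; rewrite lee_fin mul0r addr0 !addr_ge0 ?mulr_ge0// ?ltW.
  - exact: maff.
  - by move=> y _; rewrite lee_fin !addr_ge0 ?mulr_ge0// ltW.
  - exact: maff.
  apply: ge0_le_integral => //.
  - by move=> y _; rewrite lee_fin mul0r addr0 addr_ge0 ?mulr_ge0.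
  - exact: maff.
  - by apply: emeasurable_funD; exact: maff.
  - move=> y _; rewrite -EFinD lee_fin mul1r !mul0r !addr0.
    by have := H (L n y) (L0 n y); rewrite ler_norml /m => /andP[+ _]; lra.
(* The upper estimate, taken with [e = 1], already bounds [I n]. *)
have Ifin n : I n \is a fin_num.
  have [C C0 H] := main _ ltr01.
  have [+ _] := up _ _ n ltr01 C0 H.
  rewrite -(fineK (Mfin n)) -EFinM -EFinD; move: (I0 n).
  by case: (I n).
rewrite -/I (_ : I = fun n => (fine (I n))%:E); last first.
  by apply/funext => n; rewrite fineK.
apply: cvg_EFin; first by near=> n.
apply/cvgrPdist_le => /= e e0.
(* Three quarters of [e] get spent: one on the constant, one on the multiple of [L n], one on
   [C * t n]. *)
have e4 : (0 < e / 4)%R by rewrite divr_gt0.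
have [C C0 H] := main _ e4.
have : (C * t n)%R @[n --> \oo] --> (C * 0)%R.
  by apply: cvgM => //; exact: cvg_cst.
rewrite mulr0 => /cvgrPdist_le/(_ _ e4) Ht.
near=> n.
have : (`|0 - C * t n| <= e / 4)%R by near: n.
rewrite sub0r normrN => /(le_trans (ler_norm _)) Ctn.
have [] := up _ _ n e4 C0 H.
have CM : (C * fine (M n) <= C * t n)%R.
  by rewrite ler_wpM2l// -lee_fin fineK// Lt.
rewrite -(fineK (Ifin n)) -(fineK (Mfin n)) -EFinM -!EFinD !lee_fin/=.
by move=> H1 H2; rewrite ler_norml; apply/andP; split; lra.
Unshelve. all: by end_near. Qed.

End truncated_convergence.

(** * Powers tending to an exponential, and measurability of inverses *)

(** The inequality [1 + x <= expR x], used at [q - 1] and at [- (q - 1) / q], encloses [q] between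
    [expR ((q - 1) / q)] and [expR (q - 1)]. The n-th powers of both ends tend to [expR c] because
    [q n] tends to 1. *)
Lemma cvg_pow_expR (R : realType) (q : R^nat) (c : R) :
  n%:R * (q n - 1) @[n --> \oo] --> c -> q n ^+ n @[n --> \oo] --> expR c.
Proof.
move=> qc.
have q1 : q n @[n --> \oo] --> (1 : R).
  (* The shift to [n.+1] makes cancelling the factor legitimate. *)
  have q0 : n.+1%:R^-1 * (n.+1%:R * (q n.+1 - 1)) + 1 @[n --> \oo] --> 0 * c + 1.
    apply: (@cvgD _ R^o); last exact: cvg_cst.
    apply: cvgM; first exact: cvg_harmonic.
    by have := qc; rewrite -(cvg_shiftS (fun n => n%:R * (q n - 1))).
  rewrite -cvg_shiftS; move: q0; rewrite mul0r add0r.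
  by under eq_fun do rewrite mulKf// subrK.
apply: (@squeeze_cvgr _ _ _ _ (fun n => expR (n%:R * (q n - 1) * (q n)^-1))
    (fun n => expR (n%:R * (q n - 1)))).
- have : \forall n \near \oo, 0 < q n by exact: cvgr_gt q1 _ ltr01.
  apply: filterS => n q0; apply/andP; split.
    rewrite -mulrA expRM_natl lerXn2r ?nnegrE ?expR_ge0 ?(ltW q0)//.
    have := expR_ge1Dx (- ((q n - 1) / q n)).
    have -> : 1 + - ((q n - 1) / q n) = (q n)^-1 by field; rewrite gt_eqF.
    rewrite expRN.
    by rewrite lef_pV2 ?posrE ?expR_gt0.
  rewrite expRM_natl lerXn2r ?nnegrE ?expR_ge0 ?(ltW q0)//.
  by have := expR_ge1Dx (q n - 1); rewrite addrC subrK.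
- apply: continuous_cvg; first exact: continuous_expR.
  rewrite -[c]mulr1 -[X in _ * X]invr1; apply: cvgM => //.
  by apply: cvgV.
- by apply: continuous_cvg; first exact: continuous_expR.
Qed.

Lemma measurable_invr_ge0 d (T : measurableType d) (R : realType) (f : T -> R) :
  (forall x, 0 <= f x) -> measurable_fun setT f ->
  measurable_fun setT (fun x => (f x)^-1).
Proof.
move=> f0 mf; under eq_fun do rewrite -powR_inv1//.
exact: (measurableT_comp (@measurable_powR R (- 1)) mf).
Qed.

(** * One-dimensional moments of the truncated mixture density *)

Section sparse_mixture.
Context d (T : measurableType d) (R : realType).
Variables (P mu Q : probability T R) (f g : T -> R) (e : R).
Hypotheses (e01 : 0 <= e <= 1) (QE : Q = mixture e mu P).
Hypotheses (mf : measurable_fun setT f) (f0 : forall x, 0 < f x).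
Hypothesis muE :
  forall A, measurable A -> mu A = (\int[P]_(x in A) (f x)%:E)%E.
Hypotheses (mg : measurable_fun setT g) (g0 : forall x, 0 <= g x).
Hypothesis gE : forall A, measurable A -> Q A = (\int[P]_(x in A) (g x)%:E)%E.

Let h x := e * f x.
Let A := [set x | h x <= 1].
Local Open Scope ereal_scope.

Lemma truncated_moments (t : R) :
  \int[mu]_x (Num.min (h x) (h x)^-1)%:E = t%:E ->
  exists a b c : R, [/\ P A = a%:E, mu A = b%:E, (0 <= c <= t)%R,
    (0 <= e^-1 * (1 - a) <= t)%R &
    \int[P]_x (g x * \1_A x)%:E = (e * b + (1 - e) * a)%:E /\
    \int[P]_x ((g x * \1_A x) ^+ 2)%:E =
      (e * (c + (1 - e) * b) + (1 - e) * (e * b + (1 - e) * a))%:E].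
Proof.
move=> tE; have /andP[e0 e1] := e01.
have q0 : (0 <= 1 - e)%R by rewrite subr_ge0.
have f0' x : (0 <= f x)%R by exact: ltW.
have h0 x : (0 <= h x)%R by rewrite mulr_ge0.
have mh : measurable_fun setT h by exact: measurable_funM.
have mhV : measurable_fun setT (fun x => (h x)^-1)%R.
  exact: measurable_invr_ge0.
have mmin : measurable_fun setT (fun x => Num.min (h x) (h x)^-1)%R.
  exact: measurable_minr.
have min0 x : (0 <= Num.min (h x) (h x)^-1)%R by rewrite le_min invr_ge0 h0.
have mA : measurable A.
  rewrite -[A]setTI; apply: measurable_fun_le => //; exact: measurable_cst.
have m1A : measurable_fun setT (\1_A : T -> R) by exact: measurable_indic.
have ind0 B x : (0 <= \1_B x :> R)%R by rewrite indicE.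
have w0 x : (0 <= g x * \1_A x)%R by rewrite mulr_ge0.
have mw : measurable_fun setT (fun x => g x * \1_A x)%R by exact: measurable_funM.
have mfA : measurable_fun setT (fun x => \1_A x * f x)%R by exact: measurable_funM.
have mhA : measurable_fun setT (fun x => \1_A x * h x)%R by exact: measurable_funM.
have dens_f (phi : T -> R) : measurable_fun setT phi ->
    (forall x, 0 <= phi x)%R ->
    \int[mu]_x (phi x)%:E = \int[P]_x (phi x * f x)%:E.
  move=> mphi phi0; rewrite (ge0_integral_density mf f0' muE)//.
  exact/measurable_EFinP.
have dens_g (phi : T -> R) : measurable_fun setT phi ->
    (forall x, 0 <= phi x)%R ->
    \int[P]_x (phi x * g x)%:E =
    e%:E * \int[mu]_x (phi x)%:E + (1 - e)%:E * \int[P]_x (phi x)%:E.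
  move=> mphi phi0; have mphi' : measurable_fun setT (EFin \o phi).
    exact/measurable_EFinP.
  rewrite -ge0_integral_mixture//.
  under eq_integral do rewrite EFinM.
  rewrite -(ge0_integral_density mg g0 gE)//.
  by rewrite QE.
exists (fine (P A)), (fine (mu A)), (fine (\int[mu]_x (\1_A x * h x)%:E)).
set a := fine _; set b := fine _; set c := fine _.
have aE : P A = a%:E by rewrite fineK// fin_num_measure.
have bE : mu A = b%:E by rewrite fineK// fin_num_measure.
have c_le : \int[mu]_x (\1_A x * h x)%:E <= t%:E.
  rewrite -tE; apply: ge0_le_integral => //; try exact/measurable_EFinP.
  - by move=> x _; rewrite lee_fin mulr_ge0.
  - move=> x _; rewrite lee_fin indicE; case: (boolP (x \in A)) => xA /=.
      rewrite mul1r le_min lexx/=; rewrite inE /A/= in xA.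
      (* [h x] vanishes when [e = 0]; the inverse is then 0 by convention and the bound still
         holds. *)
      have [->|hx0] := eqVneq (h x) 0%R; first by rewrite invr0.
      by rewrite (le_trans xA)// invf_ge1 ?lt0r ?hx0 ?h0.
    by rewrite mul0r.
have c0 : 0 <= \int[mu]_x (\1_A x * h x)%:E.
  by apply: integral_ge0 => x _; rewrite lee_fin mulr_ge0.
have cE : \int[mu]_x (\1_A x * h x)%:E = c%:E.
  by rewrite fineK// ge0_fin_numE// (le_lt_trans c_le)// ltry.
have int1A (m : probability T R) : \int[m]_x (\1_A x)%:E = m A.
  by rewrite integral_indic// setIT.
have wP : \int[P]_x (g x * \1_A x)%:E = (e * b + (1 - e) * a)%:E.
  under eq_integral do rewrite mulrC.
  by rewrite dens_g// !int1A aE bE.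
(* First [mu] becomes [f] times [P], then [g] times [P] becomes the mixture. Its [mu] part, the
   integral of [e f] over [A], is [c]; its [P] part returns to [mu A]. *)
have wmu : e%:E * \int[mu]_x (g x * \1_A x)%:E = (e * (c + (1 - e) * b))%:E.
  rewrite EFinM; congr (_ * _); rewrite dens_f//.
  under eq_integral => x _ do rewrite -mulrA mulrC.
  rewrite dens_g//; last by move=> x; rewrite mulr_ge0.
  rewrite -dens_f// int1A bE [RHS]EFinD; congr (_ + _).
  rewrite -cE -ge0_integralZl ?lee_fin//; last 2 first.
  - exact/measurable_EFinP.
  - by move=> x _; rewrite lee_fin mulr_ge0.
  by apply: eq_integral => x _; rewrite -EFinM mulrCA.
split=> //.
- by rewrite -!lee_fin -cE c0.
- have -> : (1 - a)%R = fine (P (~` A)).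
    by rewrite probability_setC// aE -EFinB.
  rewrite mulr_ge0 ?invr_ge0 ?fine_ge0//= -lee_fin EFinM fineK; last first.
    by rewrite fin_num_measure//; exact: measurableC.
  have mAC := measurableC mA.
  have mV : measurable_fun setT (fun x => \1_(~` A) x * (f x)^-1)%R.
    apply: measurable_funM; first exact: measurable_indic.
    exact: measurable_invr_ge0.
  have V0 x : (0 <= \1_(~` A) x * (f x)^-1)%R by rewrite mulr_ge0 ?invr_ge0.
  have -> : P (~` A) = \int[mu]_x (\1_(~` A) x * (f x)^-1)%:E.
    rewrite dens_f//; transitivity (\int[P]_x (\1_(~` A) x)%:E).
      by rewrite integral_indic// setIT.
    by apply: eq_integral => x _; rewrite mulfVK ?gt_eqF.
  rewrite -ge0_integralZl ?lee_fin ?invr_ge0//; last 2 first.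
  - exact/measurable_EFinP.
  - by move=> x _; rewrite lee_fin.
  rewrite -tE; apply: ge0_le_integral => //.
  + by move=> x _; rewrite -EFinM lee_fin mulr_ge0 ?invr_ge0.
  + by apply: measurable_funeM; exact/measurable_EFinP.
  + exact/measurable_EFinP.
  + move=> x _; rewrite -EFinM lee_fin mulrCA -invfM -/(h x) indicE.
    rewrite in_setC; case: (boolP (x \in A)) => xA/=; first by rewrite mul0r.
    rewrite mul1r le_min lexx andbT; move: xA; rewrite notin_setE /A/= => /negP.
    rewrite -ltNge => h1; rewrite (le_trans _ (ltW h1))// invf_le1 ?ltW//.
    exact: lt_trans h1.
(* The indicator is idempotent, so the square is [g * \1_A] times one more [g], to which the mixture
   formula applies. *)
- split=> //; rewrite [in RHS]EFinD -wmu [in RHS]EFinM -wP -dens_g//.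
  apply: eq_integral => x _; rewrite expr2 indicE.
  by case: (x \in A); rewrite ?mulr1 ?mulr0 ?mul0r.
Qed.

End sparse_mixture.

(** * Convergence in probability of the likelihood ratio *)

Section likelihood_ratio.
Context d (T : measurableType d) (R : realType).
Local Open Scope ereal_scope.

(* On the event that no observation leaves [A] the product of the [g] equals
   its truncation, whose distance to [l] is computed from two moments. *)
Lemma likelihood_ratio_bound (P : probability T R) (g : T -> R) (A : set T)
    (a s1 s2 l : R) n :
  measurable_fun setT g -> (forall x, 0 <= g x)%R -> measurable A ->
  (0 <= l)%R -> P A = a%:E ->
  \int[P]_x (g x * \1_A x)%:E = s1%:E ->
  \int[P]_x ((g x * \1_A x) ^+ 2)%:E = s2%:E ->
  \int[iid P n]_y (Num.min 1 ((\prod_(i < n) g (tnth y i) - l) ^+ 2))%:E <=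
  (1 + s2 ^+ n + l ^+ 2 - 2 * l * s1 ^+ n - a ^+ n)%:E.
Proof.
move=> mg g0 mA l0 aE s1E s2E.
pose w x := (g x * \1_A x)%R.
have m1A : measurable_fun setT (\1_A : T -> R) by exact: measurable_indic.
have ind0 x : (0 <= \1_A x :> R)%R by rewrite indicE.
have mw : measurable_fun setT w by exact: measurable_funM.
have w0 x : (0 <= w x)%R by rewrite mulr_ge0.
have mw2 : measurable_fun setT (fun x => w x ^+ 2)%R by exact: measurable_funX.
pose M (y : n.-tuple T) :=
  Num.min 1%R ((\prod_(i < n) g (tnth y i) - l) ^+ 2)%R.
pose U (y : n.-tuple T) := (\prod_(i < n) w (tnth y i))%R.
pose W (y : n.-tuple T) := (\prod_(i < n) (w (tnth y i) ^+ 2))%R.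
pose V (y : n.-tuple T) := (\prod_(i < n) \1_A (tnth y i) : R)%R.
have mU : measurable_fun setT U by exact: measurable_prod_tnth.
have mW : measurable_fun setT W by exact: (@measurable_prod_tnth _ _ _ n (fun x => w x ^+ 2)%R).
have mV : measurable_fun setT V by exact: measurable_prod_tnth.
have mM : measurable_fun setT M.
  apply: measurable_minr; first exact: measurable_cst.
  apply: measurable_funX; apply: measurable_funB; last exact: measurable_cst.
  exact: measurable_prod_tnth.
have M0 y : (0 <= M y)%R by rewrite le_min ler01 sqr_ge0.
have U0 y : (0 <= U y)%R by exact: prodr_ge0.
have W0 y : (0 <= W y)%R by apply: prodr_ge0 => i _; rewrite sqr_ge0.
have V0 y : (0 <= V y)%R by exact: prodr_ge0.
have IU : \int[iid P n]_y (U y)%:E = (s1 ^+ n)%:E.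
  by rewrite integral_iid_prod// s1E EFin_expe.
have IW : \int[iid P n]_y (W y)%:E = (s2 ^+ n)%:E.
  rewrite (integral_iid_prod P n mw2) ?s2E ?EFin_expe// => x.
  exact: sqr_ge0.
have IV : \int[iid P n]_y (V y)%:E = (a ^+ n)%:E.
  by rewrite integral_iid_prod// integral_indic// setIT EFin_expe -aE.
pose F y := (0 + (2 * l) * U y + 1 * V y)%R.
have mF : measurable_fun setT F.
  apply: measurable_funD; last exact: measurable_funM.
  by apply: measurable_funD => //; exact: measurable_funM.
have F0 y : (0 <= F y)%R by rewrite !addr_ge0 ?mulr_ge0.
have IF : \int[iid P n]_y (F y)%:E = (2 * l * s1 ^+ n + a ^+ n)%:E.
  by rewrite integral_affine ?mulr_ge0// IU IV -!EFinM -!EFinD add0r mul1r.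
have FE y : F y = (2 * l * U y + V y)%R by rewrite /F add0r mul1r.
(* otherwise [integral_affine] would rewrite below [F] *)
clearbody F.
(* Pointwise [M + 2 l U + V <= 1 + l^2 + U^2]. If all observations lie in [A], then [V = 1] and this
   reads [M <= (U - l)^2]; otherwise [V = 0], and [M <= 1] and [0 <= (U - l)^2] add up to it. *)
have : \int[iid P n]_y (0 + 1 * F y + 1 * M y)%:E <=
    \int[iid P n]_y ((1 + l ^+ 2) + 1 * W y + 0 * U y)%:E.
  apply: ge0_le_integral => //.
  - by move=> y _; rewrite lee_fin !addr_ge0 ?mulr_ge0.
  - apply/measurable_EFinP; apply: measurable_funD; last exact: measurable_funM.
    by apply: measurable_funD => //; exact: measurable_funM.
  - apply/measurable_EFinP; apply: measurable_funD; last exact: measurable_funM.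
    by apply: measurable_funD => //; exact: measurable_funM.
  move=> y _; rewrite lee_fin add0r mul0r addr0 !mul1r FE.
  have -> : W y = (U y ^+ 2)%R by rewrite /W prodrXl.
  have [yA|yA] := boolP [forall i, tnth y i \in A].
    have -> : V y = 1%R.
      by rewrite /V big1// => i _; rewrite indicE (forallP yA i).
    have : (M y <= (U y - l) ^+ 2)%R.
      rewrite /M ge_min; apply/orP; right.
      rewrite le_eqVlt; apply/orP; left; apply/eqP; congr (_ ^+ 2)%R.
      congr (_ - _)%R; apply: eq_bigr => i _.
      by rewrite /w indicE (forallP yA i) mulr1.
    by nra.
  have -> : V y = 0%R.
    move: yA => /forallPn[i yi]; rewrite /V (bigD1 i)//= indicE (negbTE yi).
    by rewrite mul0r.
  have : (M y <= 1)%R by rewrite /M ge_min lexx.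
  have := sqr_ge0 (U y - l)%R.
  by nra.
rewrite !integral_affine ?addr_ge0 ?sqr_ge0// IF IW IU !mul1e !mul0e !adde0 add0e.
rewrite -[\int[_]_ _ _]/(\int[iid P n]_y (M y)%:E) -!EFinD => H.
have IM : \int[iid P n]_y (M y)%:E \is a fin_num.
  have : 0 <= \int[iid P n]_y (M y)%:E.
    by apply: integral_ge0 => y _; rewrite lee_fin.
  by move: H; case: (\int[iid P n]_y (M y)%:E).
rewrite -/M -(fineK IM) lee_fin.
by move: H; rewrite -(fineK IM) -EFinD lee_fin; lra.
Qed.

(** With [l = expR (p - 1)], the powers of [s1], [s2] and [a] tend to [l], [l^2] and 1, so the bound
    of [likelihood_ratio_bound] tends to [1 + l^2 + l^2 - 2 l^2 - 1 = 0]. By [cvg_pow_expR] only [n]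
    times the distance of each base from 1 has to be computed. *)
Lemma cvg_likelihood_ratio (P : probability T R) (mu : nat -> probability T R)
    (f g : nat -> T -> R) (t : R^nat) (p : R) :
  (forall n, measurable_fun setT (f n)) -> (forall n x, 0 < f n x)%R ->
  (forall n A, measurable A -> mu n A = \int[P]_(x in A) (f n x)%:E) ->
  (forall n, measurable_fun setT (g n)) -> (forall n x, 0 <= g n x)%R ->
  (forall n A, measurable A ->
    mixture n%:R^-1 (mu n) P A = \int[P]_(x in A) (g n x)%:E) ->
  (forall n, \int[mu n]_x
    (Num.min (n%:R^-1 * f n x) (n%:R^-1 * f n x)^-1)%:E = (t n)%:E) ->
  t n @[n --> \oo] --> (0 : R)%R ->
  mu n [set x | n%:R^-1 * f n x <= 1]%R @[n --> \oo] --> p%:E ->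
  exists2 s : R^nat, s n @[n --> \oo] --> (0 : R)%R &
    forall n, \int[iid P n]_y
      (Num.min 1 ((\prod_(i < n) g n (tnth y i) - expR (p - 1)) ^+ 2))%:E
      <= (s n)%:E.
Proof.
move=> mf f0 muE mg g0 gE tE t0 mup.
(* At [n = 0] the weight is 0 by the convention for inverses. *)
have e01 n : (0 <= (n%:R^-1 : R) <= 1)%R.
  rewrite invr_ge0 ler0n/=; case: n => [|n]; first by rewrite invr0.
  by rewrite invf_le1 ?ler1n ?ltr0n.
have H n := truncated_moments (e01 n) erefl (mf n) (f0 n) (muE n) (mg n) (g0 n)
  (gE n) (tE n).
have {H}[a /choice[b /choice[c H]]] := choice H.
pose e n : R := n%:R^-1%R.
pose s1 n := (e n * b n + (1 - e n) * a n)%R.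
pose s2 n := (e n * (c n + (1 - e n) * b n) + (1 - e n) * s1 n)%R.
pose l := expR (p - 1).
exists (fun n => 1 + s2 n ^+ n + l ^+ 2 - 2 * l * s1 n ^+ n - a n ^+ n)%R;
  last first.
  move=> n; have [aE _ _ _ [s1E s2E]] := H n.
  apply: (@likelihood_ratio_bound _ _ [set x | n%:R^-1 * f n x <= 1]%R) => //.
    rewrite -[X in measurable X]setTI; apply: measurable_fun_le => //.
    exact: measurable_funM.
have e0 : e n @[n --> \oo] --> (0 : R)%R.
  by rewrite -cvg_shiftS; exact: cvg_harmonic.
have na : (n%:R * (a n - 1))%R @[n --> \oo] --> (0 : R)%R.
  rewrite -[X in _ --> X]oppr0.
  apply: (@squeeze_cvgr _ _ _ _ (fun n => - t n)%R (cst 0%R)).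
  - apply: nearW => n; have [_ _ _ /andP[H1 H2] _] := H n.
    by move: H1 H2; rewrite invrK /cst; nra.
  - exact: (@cvgN _ R^o).
  - by rewrite oppr0; exact: cvg_cst.
have a1 : a n @[n --> \oo] --> (1 : R)%R.
  have : (e n * (n%:R * (a n - 1)) + 1)%R @[n --> \oo] --> (0 * 0 + 1 : R)%R.
    apply: (@cvgD _ R^o); last exact: cvg_cst.
    exact: cvgM.
  rewrite mulr0 add0r -cvg_shiftS => h; rewrite -cvg_shiftS; move: h.
  by under eq_fun do rewrite mulKf// subrK.
have b0 : b n @[n --> \oo] --> p.
  move: mup; rewrite [X in X @ _ --> _](_ : _ = fun n => (b n)%:E); last first.
    by apply/funext => n; have [] := H n.
  by move/fine_cvgP => [].
have c0 : c n @[n --> \oo] --> (0 : R)%R.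
  apply: (@squeeze_cvgr _ _ _ _ (cst 0%R) t) => //; last exact: cvg_cst.
  by apply: nearW => n; have [] := H n.
have e1 : (1 - e n)%R @[n --> \oo] --> (1 : R)%R.
  by rewrite -[X in _ --> X]subr0; apply: (@cvgB _ R^o) => //; exact: cvg_cst.
have s11 : s1 n @[n --> \oo] --> (1 : R)%R.
  rewrite -[X in _ --> X](_ : 0 * p + 1 * 1 = 1)%R; last by ring.
  by apply: (@cvgD _ R^o); apply: cvgM.
(* For nonzero [n] the product equals [b n + n (a n - 1) - a n]; hence the shift before [field]. *)
have ns1 : (n%:R * (s1 n - 1))%R @[n --> \oo] --> (p - 1)%R.
  pose u n := (b n + n%:R * (a n - 1) - a n)%R.
  have : u n @[n --> \oo] --> (p + 0 - 1)%R.
    by apply: (@cvgB _ R^o) => //; apply: (@cvgD _ R^o).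
  rewrite addr0 -cvg_shiftS => h; rewrite -cvg_shiftS.
  rewrite [X in X @ _ --> _](_ : _ = fun n => u n.+1)//; apply/funext => n.
  rewrite /u /s1 /e /=; field.
  by rewrite nat1r pnatr_eq0.
have ns2 : (n%:R * (s2 n - 1))%R @[n --> \oo] --> ((p - 1) *+ 2)%R.
  pose u n := (c n + (1 - e n) * b n + n%:R * (s1 n - 1) - s1 n)%R.
  have : u n @[n --> \oo] --> (0 + 1 * p + (p - 1) - 1)%R.
    apply: (@cvgB _ R^o) => //; apply: (@cvgD _ R^o) => //.
    by apply: (@cvgD _ R^o) => //; exact: cvgM.
  rewrite (_ : 0 + 1 * p + (p - 1) - 1 = (p - 1) *+ 2)%R; last by ring.
  rewrite -cvg_shiftS => h; rewrite -cvg_shiftS.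
  rewrite [X in X @ _ --> _](_ : _ = fun n => u n.+1)//; apply/funext => n.
  rewrite /u /s2 /e /=; field.
  by rewrite nat1r pnatr_eq0.
rewrite -[X in _ --> X](_ : 1 + l ^+ 2 + l ^+ 2 - 2 * l * l - 1 = 0)%R; last by ring.
have an1 : (a n ^+ n)%R @[n --> \oo] --> (1 : R)%R.
  by rewrite -(expR0 R); exact: cvg_pow_expR.
have s1n : (s1 n ^+ n)%R @[n --> \oo] --> l by exact: cvg_pow_expR.
have s2n : (s2 n ^+ n)%R @[n --> \oo] --> (l ^+ 2)%R.
  by rewrite /l -expRM_natr mulr_natr; exact: cvg_pow_expR.
apply: (@cvgB _ R^o) => //; apply: (@cvgB _ R^o).
  apply: (@cvgD _ R^o); last exact: cvg_cst.
  by apply: (@cvgD _ R^o) => //; exact: cvg_cst.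
by apply: cvgM => //; exact: cvg_cst.
Qed.

End likelihood_ratio.

(** * Standardization and symmetry of the normal law *)

Section normal_law.
Context (R : realType).

Lemma normal_pdf_gt0 (m s x : R) : s != 0 -> 0 < normal_pdf m s x.
Proof.
by move=> s0; rewrite normal_pdfE// mulr_gt0 ?expR_gt0// normal_peak_gt0.
Qed.

Lemma normal_pdf01E (x : R) :
  normal_pdf 0 1 x = normal_peak 1 * expR (- (x ^+ 2 / 2)).
Proof.
rewrite normal_pdfE ?oner_neq0// /normal_fun subr0 expr1n.
by rewrite mulNr.
Qed.

Lemma normal_pdf_affine (m s z : R) : 0 < s ->
  normal_pdf m s (m + s * z) = s^-1 * normal_pdf 0 1 z.
Proof.
move=> s0; rewrite normal_pdf01E normal_pdfE ?gt_eqF// mulrA; congr (_ * _).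
  rewrite /normal_peak expr1n mul1r -mulrnAr sqrtrM ?sqr_ge0//.
  by rewrite sqrtr_sqr gtr0_norm// invfM.
congr expR; rewrite /=; field; rewrite gt_eqF//.
Qed.

Lemma ge0_integral_normal_prob (m s : R) (phi : R -> \bar R) :
  measurable_fun setT phi -> (forall x, (0 <= phi x)%E) ->
  (\int[normal_prob m s]_x phi x =
   \int[lebesgue_measure]_x (phi x * (normal_pdf m s x)%:E))%E.
Proof.
move=> mphi phi0; apply: ge0_integral_density => //.
- exact: measurable_normal_pdf.
- by move=> x; exact: normal_pdf_ge0.
Qed.

(** Substitution on the whole line asks for a continuous integrand, which is why the truncations
    used under [mun] are continuous. *)
Lemma integral_normal_prob_affine (m s : R) (phi : R -> R) : 0 < s ->
  continuous phi -> (forall x, 0 <= phi x) ->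
  (\int[normal_prob m s]_x (phi x)%:E =
   \int[normal_prob 0 1]_z (phi (m + s * z))%:E)%E.
Proof.
move=> s0 cphi phi0.
have mphi : measurable_fun setT (EFin \o phi).
  by apply/measurable_EFinP; exact: continuous_measurable_fun.
pose F (z : R) : R := m + s * z.
have dF (x : R) : is_derive x 1 F s.
  have H := is_deriveD (is_derive_cst m x 1)
    (is_deriveM (is_derive_cst s x 1) (is_derive_id x 1)).
  apply: (is_derive_eq H).
  by rewrite /cst/= add0r scaler0 addr0 [LHS]mulr1.
have F'E : F^`()%classic = cst s.
  by apply/funext => x; rewrite derive1E; apply: derive_val.
have cF : continuous F.
  move=> x; apply: (@cvgD _ R^o); first exact: cvg_cst.
  by apply: (@cvgM R _ _ _ (cst s) id); [exact: cvg_cst|exact: cvg_id].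
have mphiF : measurable_fun setT (fun z => (phi (F z))%:E).
  exact: (measurableT_comp mphi (continuous_measurable_fun cF)).
rewrite [LHS](ge0_integral_normal_prob m s mphi); last first.
  by move=> x; rewrite lee_fin.
rewrite [RHS](ge0_integral_normal_prob 0 1 mphiF); last first.
  by move=> x; rewrite lee_fin.
transitivity (\int[lebesgue_measure]_x (phi x * normal_pdf m s x)%:E)%E.
  by apply: eq_integral.
rewrite (@increasing_ge0_integration_by_substitutionT _ F
    (fun x => phi x * normal_pdf m s x)).
- apply: eq_integral => z _; rewrite F'E -EFinM !fctE /F normal_pdf_affine//.
  by congr (_%:E); field; rewrite gt_eqF.
- by move=> x y xy; rewrite /F ltrD2l ltr_pM2l.
- by rewrite F'E => x; exact: cvg_cst.
- by rewrite F'E; exact: is_cvg_cst.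
- by rewrite F'E; exact: is_cvg_cst.
- by move=> x; exact: ex_derive.
- apply: (cvg_comp (fun z => s * z) (fun x => m + x)); last exact: cvg_addrl_Ny.
  by apply: gt0_cvgMrNy => //; exact: cvg_id.
- apply: (cvg_comp (fun z => s * z) (fun x => m + x)); last exact: cvg_addrl.
  by apply: gt0_cvgMry => //; exact: cvg_id.
- move=> x; apply: cvgM; first exact: cphi.
  by apply: continuous_normal_pdf; rewrite gt_eqF.
- by move=> x; rewrite mulr_ge0 ?normal_pdf_ge0.
Qed.

Lemma normal_prob_set1 (m s a : R) : normal_prob m s [set a] = 0%E.
Proof.
have /null_content_dominatesP := @normal_prob_dominates _ m s.
by apply => //; exact: lebesgue_measure_set1.
Qed.

(** Reflection exchanges the two closed half-lines, and their masses add up to 1 since their common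
    point 0 is null. *)
Lemma normal_prob01_le0 : normal_prob 0 1 `]-oo, (0 : R)] = (2^-1)%:E.
Proof.
have mpdf : measurable_fun setT (fun x : R => (normal_pdf 0 1 x)%:E).
  by apply/measurable_EFinP; exact: measurable_normal_pdf.
have pdf0 (x : R) : (0 <= (normal_pdf 0 1 x)%:E)%E.
  by rewrite lee_fin normal_pdf_ge0.
have sym : normal_prob 0 1 `[(0 : R), +oo[ = normal_prob 0 1 `]-oo, (0 : R)].
  rewrite /normal_prob (ge0_integration_by_substitution0 mpdf pdf0).
  by apply: eq_integral => x _; rewrite !normal_pdf01E sqrrN.
have half (x : \bar R) : (x + x = 1)%E -> x = (2^-1)%:E.
  by case: x => // x [xx]; congr (_%:E); lra.
apply: half; transitivity
  (normal_prob 0 1 `]-oo, 0%R : R] + normal_prob 0 1 `[0%R : R, +oo[)%E.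
  by congr (_ + _)%E; rewrite sym.
rewrite -(probability_setT (normal_prob 0 1)) -(setUv `]-oo, (0 : R)]%classic).
rewrite [RHS]measureU ?setICr//; last exact: measurableC.
rewrite setCitvl; congr (_ + _)%E.
rewrite -(@setU1itv _ _ _ _ false)//.
rewrite [LHS]measureU//; first by rewrite [X in (X + _)%E]normal_prob_set1 add0e.
by apply/seteqP; split => // x []/= ->; rewrite in_itv/= ltxx.
Qed.

End normal_law.

(** * Limits of truncated exponentials and of their integrals *)

Section exponential_truncations.
Context (R : realType).

(** The alternative [0 < k] serves [r != 1]; at [r = 1] the square disappears and the linear term
    decides. *)
Lemma cvg_quadratic_pinfty (u : R^nat) (k b c : R) :
  u n @[n --> \oo] --> +oo -> 0 < k \/ k = 0 /\ 0 < b ->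
  k * u n ^+ 2 + b * u n + c @[n --> \oo] --> +oo.
Proof.
move=> /cvgryPge uoo kb; apply/cvgryPge => A.
case: kb => [k0|[-> b0]].
  near=> n.
  have u1 : 1 <= u n by near: n; exact: uoo.
  (* This threshold gives [k * u n + b >= |A - c|], and a further factor [u n >= 1] only helps. *)
  have un : (`|A - c| + `|b|) / k <= u n by near: n; exact: uoo.
  rewrite ler_pdivrMr// in un.
  have := ler_norm (A - c); have := ler_norm (- b); rewrite normrN => H1 H2.
  have H3 := normr_ge0 (A - c).
  have H4 : `|A - c| <= k * u n + b by lra.
  have : `|A - c| <= u n * (k * u n + b).
    by rewrite (le_trans H4)// ler_peMl// (le_trans H3).
  by nra.
near=> n.
have un : (A - c) / b <= u n by near: n; exact: uoo.
by rewrite ler_pdivrMr// in un; lra.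
Unshelve. all: by end_near. Qed.

Lemma cvg_expRN_pinfty (E : R^nat) :
  E n @[n --> \oo] --> +oo -> expR (- E n) @[n --> \oo] --> (0 : R).
Proof. by move=> Eoo; apply: (cvg_comp E (fun x => expR (- x)) Eoo); exact: cvgr_expR. Qed.

Lemma cvg_expR_ninfty (E : R^nat) :
  E n @[n --> \oo] --> -oo -> expR (E n) @[n --> \oo] --> (0 : R).
Proof.
move=> Eoo; under eq_fun do rewrite -[E _]opprK.
by apply: (@cvg_expRN_pinfty (fun n => - E n)); exact/cvgNry.
Qed.

(** Pointwise limits for [h = expR (E n)]: [min(h, 1/h)] vanishes in both directions of divergence,
    whereas [min(1, 1/h)] tells them apart. *)
Lemma cvg_minV_pinfty (E : R^nat) : E n @[n --> \oo] --> +oo ->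
  Num.min (expR (E n)) (expR (E n))^-1 @[n --> \oo] --> (0 : R).
Proof.
move=> /cvg_expRN_pinfty; apply: squeeze_cvgr (cvg_cst 0).
apply: nearW => n; rewrite expRN /cst le_min invr_ge0 expR_ge0/=.
by rewrite ge_min lexx orbT.
Qed.

Lemma cvg_minV_ninfty (E : R^nat) : E n @[n --> \oo] --> -oo ->
  Num.min (expR (E n)) (expR (E n))^-1 @[n --> \oo] --> (0 : R).
Proof.
move=> /cvg_expR_ninfty; apply: squeeze_cvgr (cvg_cst 0).
apply: nearW => n; rewrite /cst le_min invr_ge0 expR_ge0/=.
by rewrite ge_min lexx.
Qed.

Lemma cvg_min1V_pinfty (E : R^nat) : E n @[n --> \oo] --> +oo ->
  Num.min 1 (expR (E n))^-1 @[n --> \oo] --> (0 : R).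
Proof.
move=> /cvg_expRN_pinfty; apply: squeeze_cvgr (cvg_cst 0).
apply: nearW => n; rewrite expRN /cst le_min invr_ge0 expR_ge0/= ler01/=.
by rewrite ge_min lexx orbT.
Qed.

Lemma cvg_min1V_ninfty (E : R^nat) : E n @[n --> \oo] --> -oo ->
  Num.min 1 (expR (E n))^-1 @[n --> \oo] --> (1 : R).
Proof.
move=> /cvgrNyPle/(_ 0) Eoo; apply: cvg_near_cst; move: Eoo.
apply: filterS => n E0; rewrite min_l//.
by rewrite -expRN -expR0 ler_expR oppr_ge0.
Qed.

Lemma cvg_integral_unit d (T : measurableType d) (P : probability T R)
    (w : nat -> T -> R) (w0 : T -> R) (N : set T) :
  (forall n, measurable_fun setT (w n)) -> measurable_fun setT w0 ->
  (forall n x, 0 <= w n x <= 1) ->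
  measurable N -> P N = 0%E ->
  (forall x, ~ N x -> w n x @[n --> \oo] --> w0 x) ->
  (\int[P]_x (w n x)%:E)%E @[n --> \oo] --> (\int[P]_x (w0 x)%:E)%E.
Proof.
move=> mw mw0 w01 mN N0 ww0.
have [] := @dominated_convergence _ _ _ P setT measurableT
  (fun n => EFin \o w n) (EFin \o w0) (cst 1%E) => //.
- by move=> n; exact/measurable_EFinP.
- exact/measurable_EFinP.
- exists N; split => // x /=; apply: contra_notP => Nx _.
  by apply: cvg_EFin (ww0 _ Nx); exact: nearW.
- apply/integrableP; split; first exact: measurable_cst.
  by rewrite integral_cst//= normr1 mul1e -ge0_fin_numE// fin_num_measure.
- apply: aeW => x n _ /=; rewrite lee_fin.
  by have /andP[? ?] := w01 n x; rewrite ger0_norm.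
Qed.

Lemma integral_unit_fin_num d (T : measurableType d) (P : probability T R)
    (w : T -> R) :
  measurable_fun setT w -> (forall x, 0 <= w x <= 1) ->
  (\int[P]_x (w x)%:E \is a fin_num)%E.
Proof.
move=> mw w01.
have w0 x : (0 <= (w x)%:E)%E by have /andP[] := w01 x; rewrite lee_fin.
rewrite ge0_fin_numE; last by apply: integral_ge0.
apply: (@le_lt_trans _ _ (\int[P]_x (cst 1%E) x)%E).
  apply: ge0_le_integral => //; first exact/measurable_EFinP.
  by move=> x _; have /andP[_] := w01 x; rewrite lee_fin.
by rewrite integral_cst// mul1e -ge0_fin_numE// fin_num_measure.
Qed.

(** Replaces the discontinuous indicator of [h <= 1] by the continuous [min(1, 1/h)]. The two agree
    where [h <= 1]; elsewhere the error is [1/h = min(h, 1/h)]. *)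
Lemma truncation_sandwich d (T : measurableType d) (P : probability T R)
    (h : T -> R) :
  measurable_fun setT h -> (forall x, 0 < h x) ->
  (P [set x | h x <= 1]%R <= \int[P]_x (Num.min 1 (h x)^-1)%:E <=
   P [set x | h x <= 1]%R + \int[P]_x (Num.min (h x) (h x)^-1)%:E)%E.
Proof.
move=> mh h0; pose A := [set x | h x <= 1].
have mA : measurable A.
  by rewrite -[X in measurable X]setTI; apply: measurable_fun_le.
have mhV : measurable_fun setT (fun x => (h x)^-1).
  by apply: measurable_invr_ge0 => // x; exact: ltW.
have mm : measurable_fun setT (fun x => (Num.min 1 (h x)^-1)%:E).
  by apply/measurable_EFinP; apply: measurable_minr.
have mk : measurable_fun setT (fun x => (Num.min (h x) (h x)^-1)%:E).
  by apply/measurable_EFinP; exact: measurable_minr.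
have m0 x : 0 <= Num.min 1 (h x)^-1 by rewrite le_min ler01 invr_ge0 ltW.
have k0 x : 0 <= Num.min (h x) (h x)^-1 by rewrite le_min invr_ge0 !ltW.
have m1A : measurable_fun setT (fun x => (\1_A x : R)%:E).
  by apply/measurable_EFinP; exact: measurable_indic.
rewrite -/A -(setIT A) -(@integral_indic _ _ _ P _ measurableT A mA).
rewrite -ge0_integralD//; last by move=> x _; rewrite lee_fin.
apply/andP; split; apply: ge0_le_integral => //.
- move=> x _; rewrite lee_fin indicE; have [|] := boolP (x \in A) => //=.
  by rewrite inE => hx; rewrite le_min lexx invf_ge1.
- by move=> x _; rewrite lee_fin.
- exact: emeasurable_funD.
- move=> x _; rewrite -EFinD lee_fin indicE; have [|] := boolP (x \in A) => /=.
    by rewrite ge_min lerDl k0.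
  rewrite notin_setE /A/= => /negP; rewrite -ltNge => hx.
  rewrite add0r [leRHS]min_r ?ge_min ?lexx ?orbT//.
  by rewrite (le_trans _ (ltW hx))// invf_le1 ?ltW.
Qed.

End exponential_truncations.

(** * The density ratio of the shifted normal law *)

Section normal_likelihood_ratio.
Context (R : realType) (sigma0 r : R).
Hypotheses (sigma0_gt0 : 0 < sigma0) (r_gt0 : 0 < r).

Definition normal_ratio n (x : R) : R :=
  normal_pdf (theta r n) sigma0 x / normal_pdf 0 1 x.

Local Notation h n x := (n%:R^-1 * normal_ratio n x).

Lemma normal_ratio_gt0 n x : 0 < normal_ratio n x.
Proof. by rewrite divr_gt0 ?normal_pdf_gt0 ?oner_neq0 ?gt_eqF. Qed.

Lemma continuous_normal_ratio n : continuous (normal_ratio n).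
Proof.
move=> x; apply: cvgM; first by apply: continuous_normal_pdf; rewrite gt_eqF.
apply: cvgV; first by rewrite gt_eqF// normal_pdf_gt0 ?oner_neq0.
by apply: continuous_normal_pdf; rewrite oner_neq0.
Qed.

Lemma measurable_normal_ratio n : measurable_fun setT (normal_ratio n).
Proof. exact: continuous_measurable_fun (@continuous_normal_ratio n). Qed.

Lemma mun_density n (A : set R) : measurable A ->
  (mun sigma0 r n A = \int[P0 R]_(x in A) (normal_ratio n x)%:E)%E.
Proof.
move=> mA; rewrite integral_mkcond /P0 ge0_integral_normal_prob; last 2 first.
- apply/(measurable_restrictT _ mA)/measurable_funTS/measurable_EFinP.
  exact: measurable_normal_ratio.
- move=> x; rewrite /patch; case: ifPn => // _.
  by rewrite lee_fin ltW// normal_ratio_gt0.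
transitivity (\int[lebesgue_measure]_(x in A)
  (normal_pdf (theta r n) sigma0 x)%:E)%E; first by [].
rewrite integral_mkcond; apply: eq_integral => x _.
rewrite /patch; case: ifPn => _; last by rewrite mul0e.
by rewrite -EFinM divfK// gt_eqF// normal_pdf_gt0 ?oner_neq0.
Qed.

Let E n z : R := (r - 1) / (2 * r) * theta r n ^+ 2 +
  sigma0 * z * theta r n + ((sigma0 ^+ 2 - 1) / 2 * z ^+ 2 - ln sigma0).

(** Expressing [ln n] as [theta^2 / (2 r)] turns the whole exponent into a polynomial in [theta];
    the leading coefficient is [1/2 - 1/(2 r)]. *)
Lemma normal_ratio_affine n z : (0 < n)%N ->
  h n (theta r n + sigma0 * z) = expR (E n z).
Proof.
move=> n0; have nR : 0 < n%:R :> R by rewrite ltr0n.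
rewrite /normal_ratio normal_pdf_affine// !normal_pdf01E.
have ln_n : ln (n%:R : R) = theta r n ^+ 2 / (2 * r).
  rewrite /theta sqr_sqrtr; last by rewrite mulr_ge0 ?ln_ge0 ?ler1n// mulr_ge0// ltW.
  by field; rewrite gt_eqF.
have peak0 : normal_peak 1 != 0 :> R by rewrite gt_eqF// normal_peak_gt0 ?oner_neq0.
have -> : E n z = - ln n%:R - ln sigma0 - z ^+ 2 / 2 +
    (theta r n + sigma0 * z) ^+ 2 / 2.
  by rewrite ln_n /E; field; rewrite gt_eqF.
rewrite !expRD !expRN !lnK ?posrE//.
have e1 := expR_gt0 (z ^+ 2 / 2).
have e2 := expR_gt0 ((theta r n + sigma0 * z) ^+ 2 / 2).
by field; rewrite peak0 !gt_eqF.
Qed.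

Lemma cvg_theta : theta r n @[n --> \oo] --> +oo.
Proof.
apply/cvgryPge => A.
have /cvgryPge/(_ (expR (A ^+ 2 / (2 * r)))) := @cvgr_idn R.
apply: filterS => n nA.
rewrite (le_trans (ler_norm A))// -sqrtr_sqr ler_wsqrtr//.
rewrite -ler_pdivrMl ?mulr_gt0// mulrC -[leLHS]expRK ler_ln ?posrE ?expR_gt0//.
exact: lt_le_trans (expR_gt0 _) nA.
Qed.

(* The set where the exponent [E n z] tends to -oo rather than +oo; only the
   point z = 0 is misplaced, when r = 1. *)
Let B : set R := [set z | (r < 1) || (r == 1) && (z <= 0)].

Let cvgE_in z : z != 0 -> B z -> E n z @[n --> \oo] --> -oo.
Proof.
move=> z0 Bz; apply/cvgNry.
rewrite (_ : - _ = fun n => (1 - r) / (2 * r) * theta r n ^+ 2 +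
  (- (sigma0 * z)) * theta r n - ((sigma0 ^+ 2 - 1) / 2 * z ^+ 2 - ln sigma0)).
  apply: cvg_quadratic_pinfty; first exact: cvg_theta.
  move: Bz => /orP[r1|/andP[/eqP -> zle0]]; [left|right].
    by rewrite divr_gt0 ?subr_gt0 ?mulr_gt0.
  by rewrite subrr mul0r oppr_gt0 pmulr_rlt0// lt_neqAle z0.
by apply/funext => n; rewrite !fctE /E; ring.
Qed.

Let cvgE_notin z : z != 0 -> ~ B z -> E n z @[n --> \oo] --> +oo.
Proof.
move=> z0 /negP; rewrite negb_or negb_and -leNgt -ltNge => /andP[r1 rz].
apply: cvg_quadratic_pinfty; first exact: cvg_theta.
have [r1'|r1'] := eqVneq r 1; [right|left].
  by move: rz; rewrite r1' eqxx/= subrr mul0r => z0'; rewrite mulr_gt0.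
by rewrite divr_gt0 ?subr_gt0 ?mulr_gt0// lt_neqAle eq_sym r1'.
Qed.

Let near_ratio z : \forall n \near \oo,
  h n (theta r n + sigma0 * z) = expR (E n z).
Proof. by near=> n; apply: normal_ratio_affine; near: n; exact: nbhs_infty_gt.
Unshelve. all: by end_near. Qed.

Let BE : B = if r < 1 then setT else if r == 1 then `]-oo, 0]%classic else set0.
Proof.
rewrite /B; case: (r < 1) => /=; last case: (r == 1) => /=.
- by apply/seteqP; split.
- by apply/seteqP; split => z /=; rewrite in_itv.
- by apply/seteqP; split.
Qed.

Let mB : measurable B.
Proof. by rewrite BE; case: ifP => // _; case: ifP. Qed.

(** The limit [p] of the [mun]-probability of [h <= 1]. *)
Definition light_mass : R := if r < 1 then 1 else if r == 1 then 2^-1 else 0.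

Let P0B : P0 R B = light_mass%:E.
Proof.
rewrite BE /light_mass; case: ifP => _; first exact: probability_setT.
by case: ifP => _; [exact: normal_prob01_le0|exact: measure0].
Qed.

Let continuous_ratioV n : continuous (fun x => (h n x)^-1).
Proof.
move=> x; under eq_fun do rewrite invfM.
apply: cvgM; first exact: cvg_cst.
by apply: cvgV; [rewrite gt_eqF// normal_ratio_gt0|exact: continuous_normal_ratio].
Qed.

Let continuous_ratio n : continuous (fun x => h n x).
Proof. by move=> x; apply: cvgM; [exact: cvg_cst|exact: continuous_normal_ratio]. Qed.

Let ratio_ge0 n x : 0 <= h n x.
Proof. by rewrite mulr_ge0 ?invr_ge0 ?ler0n// ltW// normal_ratio_gt0. Qed.

Let continuous_affine n : continuous (fun z : R => theta r n + sigma0 * z).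
Proof.
move=> z; apply: (@cvgD _ R^o); first exact: cvg_cst.
by apply: (@cvgM R _ _ _ (cst sigma0) id); [exact: cvg_cst|exact: cvg_id].
Qed.

(** Standardizing moves the dependence on [n] from the measure into the integrand, so dominated
    convergence applies; the excluded point 0 is null. *)
Let cvg_integral_mun (w : nat -> R -> R) (w0 : R -> R) :
  (forall n, continuous (w n)) -> measurable_fun setT w0 ->
  (forall n x, 0 <= w n x <= 1) ->
  (forall z, z != 0 -> w n (theta r n + sigma0 * z) @[n --> \oo] --> w0 z) ->
  (\int[mun sigma0 r n]_x (w n x)%:E)%E @[n --> \oo] -->
  (\int[P0 R]_z (w0 z)%:E)%E.
Proof.
move=> cw mw0 w01 ww0.
rewrite [X in X @ _ --> _](_ : _ =
    fun n => (\int[P0 R]_z (w n (theta r n + sigma0 * z))%:E)%E); last first.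
  apply/funext => n; apply: integral_normal_prob_affine => // x.
  by have /andP[] := w01 n x.
apply: (@cvg_integral_unit _ _ _ (P0 R)
  (fun n z => w n (theta r n + sigma0 * z)) w0 [set 0]) => //.
- move=> n; apply: continuous_measurable_fun => z.
  exact: (continuous_comp (@continuous_affine n z) (cw n _)).
- exact: normal_prob_set1.
- by move=> z /eqP; exact: ww0.
Qed.

Lemma cvg_mun_truncations : exists t : R^nat, [/\
  forall n, (\int[mun sigma0 r n]_x (Num.min (h n x) (h n x)^-1)%:E =
    (t n)%:E)%E,
  t n @[n --> \oo] --> (0 : R) &
  mun sigma0 r n [set x | h n x <= 1] @[n --> \oo] --> light_mass%:E].
Proof.
pose k n x := Num.min (h n x) (h n x)^-1.
pose m n x := Num.min 1 (h n x)^-1.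
have k01 n x : 0 <= k n x <= 1.
  rewrite le_min ratio_ge0 invr_ge0 ratio_ge0/= ge_min.
  have [h1|h1] := leP (h n x) 1 => //=.
  by rewrite invf_le1 ?ltW// (lt_trans _ h1).
have m01 n x : 0 <= m n x <= 1.
  by rewrite le_min ler01 invr_ge0 ratio_ge0/= ge_min lexx.
have ck n : continuous (k n).
  move=> x; exact: (@continuous_min _ _ (fun x => h n x) (fun x => (h n x)^-1) x
    (@continuous_ratio n x) (@continuous_ratioV n x)).
have cm n : continuous (m n).
  move=> x; exact: (@continuous_min _ _ (cst 1) (fun x => (h n x)^-1) x
    (cvg_cst _) (@continuous_ratioV n x)).
have kcvg : (\int[mun sigma0 r n]_x (k n x)%:E)%E @[n --> \oo] --> 0%E.
  rewrite -[X in _ --> X](integral0 (P0 R) setT).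
  apply: (cvg_integral_mun (w0 := cst 0)) => // z z0.
  apply: (@cvg_trans _ ((Num.min (expR (E n z)) (expR (E n z))^-1) @[n --> \oo])).
    by apply: near_eq_cvg; apply: filterS (near_ratio z) => n; rewrite /k => ->.
  have [Bz|Bz] := pselect (B z).
    by apply: cvg_minV_ninfty; exact: cvgE_in.
  by apply: cvg_minV_pinfty; exact: cvgE_notin.
have mcvg : (\int[mun sigma0 r n]_x (m n x)%:E)%E @[n --> \oo] --> light_mass%:E.
  rewrite -P0B -(setIT B) -integral_indic//.
  apply: (cvg_integral_mun (w0 := \1_B)) => // z z0.
  apply: (@cvg_trans _ ((Num.min 1 (expR (E n z))^-1) @[n --> \oo])).
    by apply: near_eq_cvg; apply: filterS (near_ratio z) => n; rewrite /m => ->.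
  have [Bz|Bz] := pselect (B z).
    by rewrite indicE mem_set//; apply: cvg_min1V_ninfty; exact: cvgE_in.
  by rewrite indicE memNset//; apply: cvg_min1V_pinfty; exact: cvgE_notin.
have kfin n : (\int[mun sigma0 r n]_x (k n x)%:E \is a fin_num)%E.
  apply: (@integral_unit_fin_num _ _ _ (mun sigma0 r n) (k n)); last exact: k01.
  exact: continuous_measurable_fun.
have mfin n : (\int[mun sigma0 r n]_x (m n x)%:E \is a fin_num)%E.
  apply: (@integral_unit_fin_num _ _ _ (mun sigma0 r n) (m n)); last exact: m01.
  exact: continuous_measurable_fun.
(* Only eventual, because the ratio is positive only for [n > 0]. As the integrals of [k n] vanish,
   both ends tend to [light_mass]. *)
have sandwich : \forall n \near \oo,
    ((\int[mun sigma0 r n]_x (m n x)%:E - \int[mun sigma0 r n]_x (k n x)%:E)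
      <= mun sigma0 r n [set x | h n x <= 1]%R
      <= \int[mun sigma0 r n]_x (m n x)%:E)%E.
  near=> n; have n0 : (0 < n)%N by near: n; exact: nbhs_infty_gt.
  have h0 x : 0 < h n x by rewrite mulr_gt0 ?normal_ratio_gt0// invr_gt0 ltr0n.
  have /andP[H1 H2] := truncation_sandwich (mun sigma0 r n)
    (continuous_measurable_fun (@continuous_ratio n)) h0.
  by rewrite H1 leeBlDr// H2.
exists (fun n => fine (\int[mun sigma0 r n]_x (k n x)%:E)%E); split.
- by move=> n; rewrite fineK.
- by have /fine_cvgP[] := kcvg.
- apply: (squeeze_cvge sandwich) => //.
  rewrite -[X in _ --> X]sube0; apply: cvgeB => //.
Unshelve. all: by end_near. Qed.

End normal_likelihood_ratio.

(** * The log-likelihood as the logarithm of a product of densities *)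

Section log_likelihood_density.
Context d (T : measurableType d) (R : realType).

(** A zero factor is harmless: its logarithm is [-oo] and that of the other, real, factor is below
    [+oo]. *)
Lemma lne_mul (a b : R) : 0 <= a -> 0 <= b ->
  lne (a * b)%:E = (lne a%:E + lne b%:E)%E.
Proof.
rewrite le_eqVlt => /predU1P[<- b0|a0].
  by rewrite mul0r /= lexx; case: ifP.
rewrite le_eqVlt => /predU1P[<-|b0].
  by rewrite mulr0 /= lexx leNgt a0.
by rewrite EFinM lneM// in_itv/= lte_fin leey andbT.
Qed.

Lemma lne_prod n (a : 'I_n -> R) : (forall i, 0 <= a i) ->
  lne (\prod_(i < n) a i)%:E = (\sum_(i < n) lne (a i)%:E)%E.
Proof.
elim: n a => [|n IH] a a0; first by rewrite !big_ord0 lne1.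
by rewrite !big_ord_recl lne_mul ?prodr_ge0// IH.
Qed.

Variables (P Q : probability T R).
Hypothesis QP : charge_of_finite_measure Q `<< P.

(** The derivative is determined only almost everywhere and may be negative on a null set. Clipping
    at 0 gives a version that is nonnegative everywhere and leaves [lne] unchanged, since [lne] is
    [-oo] at all nonpositive values. *)
Definition density (x : T) : R :=
  Num.max 0 (fine (Radon_Nikodym (charge_of_finite_measure Q) P x)).

Lemma density_ge0 x : 0 <= density x.
Proof. by rewrite le_max lexx. Qed.

Lemma measurable_density : measurable_fun setT density.
Proof.
apply: measurable_maxr; first exact: measurable_cst.
apply: measurableT_comp; first exact: fine_measurable.
exact: measurable_int (Radon_Nikodym_integrable QP).
Qed.

Lemma densityE A : measurable A -> Q A = (\int[P]_(x in A) (density x)%:E)%E.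
Proof.
move=> mA; have QP' : Q `<< P by [].
rewrite (Radon_Nikodym_SigmaFinite.f_integral QP' mA).
have mf := measurable_int _ (Radon_Nikodym_SigmaFinite.f_integrable QP').
apply: ge0_ae_eq_integral => //.
- exact: measurable_funTS.
- by apply: measurable_funTS; apply/measurable_EFinP; exact: measurable_density.
- by move=> x _; exact: Radon_Nikodym_SigmaFinite.f_ge0.
- by move=> x _; rewrite lee_fin density_ge0.
- have := ae_eq_Radon_Nikodym_SigmaFinite QP' mA.
  apply: filterS => x /= fx Ax; rewrite /density -fx//.
  have := Radon_Nikodym_SigmaFinite.f_ge0 QP' x.
  rewrite -(fineK (Radon_Nikodym_SigmaFinite.f_fin_num QP' x)) lee_fin => f0.
  by rewrite max_r.
Qed.

Lemma log_likelihoodE n (y : n.-tuple T) :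
  log_likelihood P Q y = lne (\prod_(i < n) density (tnth y i))%:E.
Proof.
rewrite lne_prod; last by move=> i; exact: density_ge0.
apply: eq_bigr => i _; rewrite /density.
have := Radon_Nikodym_fin_num (tnth y i) QP.
case: (Radon_Nikodym _ _ _) => // x _.
by rewrite [fine _]/=; have [//|x0] := leP 0 x; rewrite /= lexx ltW.
Qed.

End log_likelihood_density.

(** * Test functions on the compactified line *)

Section weak_convergence.
Context (R : realType).

Lemma continuous_ereal_measurable (f : \bar R -> R) : continuous f ->
  measurable_fun setT f.
Proof.
move=> cf; have cfE : continuous (f \o EFin).
  by move=> x; apply: continuous_comp; [apply: cvg_EFin; [exact: nearW|exact: cvg_id]|exact: cf].
rewrite (_ : f = fun x => if x == +oo%E then f +oo%E else
    if x == -oo%E then f -oo%E else (f \o EFin) (fine x)).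
  apply: measurable_fun_ifT => //; first exact: measurable_fun_eqe.
  apply: measurable_fun_ifT => //; first exact: measurable_fun_eqe.
  apply: measurableT_comp; first exact: continuous_measurable_fun.
  exact: fine_measurable.
by apply/funext => -[].
Qed.

(** Adding the bound [M] to a test function makes it nonnegative and shifts every expectation by the
    same constant. *)
Lemma weakly_converges_nneg (nu_ : nat -> probability (\bar R) R)
    (nu : probability (\bar R) R) :
  (forall F : \bar R -> R, continuous F ->
    (exists C, forall x, 0 <= F x <= C) ->
    (\int[nu_ n]_x (F x)%:E)%E @[n --> \oo] --> (\int[nu]_x (F x)%:E)%E) ->
  weakly_converges nu_ nu.
Proof.
move=> H f cf [M fM]; rewrite unlock.
have mf := continuous_ereal_measurable cf.
pose F x := f x + M.
have F0 x : 0 <= F x <= M + M.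
  by have := fM x; rewrite ler_norml /F => /andP[]; lra.
have cF : continuous F.
  by move=> x; apply: (@cvgD _ R^o); [exact: cf|exact: cvg_cst].
have int_cst (m : probability (\bar R) R) (c : R) :
    m.-integrable setT (EFin \o cst c).
  exact: finite_measure_integrable_cst.
have fE (m : probability (\bar R) R) :
    (\int[m]_x (f x)%:E = \int[m]_x (F x)%:E - M%:E)%E.
  have intF : m.-integrable setT (EFin \o F).
    apply: (le_integrable _ _ _ (int_cst m (M + M))) => //.
      apply/measurable_EFinP; exact: continuous_ereal_measurable.
    move=> x _; have /andP[H1 H2] := F0 x.
    by rewrite lee_fin /= !ger0_norm// (le_trans H1).
  have -> : (M%:E = \int[m]_x (cst M x)%:E)%E.
    by rewrite [RHS](integral_cst m measurableT M%:E)
      [X in (_ * X)%E]probability_setT mule1.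
  rewrite -integralB//; last exact: int_cst.
  by apply: eq_integral => x _; rewrite -EFinB /F addrK.
rewrite fE; under eq_fun do rewrite fE.
apply: cvgeB => //; last exact: cvg_cst.
  by rewrite fin_num_adde_defl.
by apply: H => //; exists (M + M).
Qed.

Lemma continuous_lne (l : R) : 0 < l -> {for l, continuous (fun x : R => lne x%:E)}.
Proof.
move=> l0.
suff : lne x%:E @[x --> l] --> (ln l)%:E by rewrite -(lne_EFin l0).
have cvg_ln : (ln x)%:E @[x --> l] --> (ln l)%:E.
  by apply: cvg_EFin; [exact: nearW|exact: continuous_ln].
apply: cvg_trans cvg_ln; apply: near_eq_cvg.
have : \forall x \near l, 0 < x by exact: lt_nbhsr.
by apply: filterS => x x0; rewrite lne_EFin.
Qed.

End weak_convergence.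

(** * From convergence of the likelihood ratio to limit laws and tests *)

Section iid_likelihood.
Context d (T : measurableType d) (R : realType).
Variables (P : probability T R) (Q : nat -> probability T R).
Hypothesis QP : forall n, charge_of_finite_measure (Q n) `<< P.
Variables (l : R) (s : R^nat).
Hypothesis l0 : 0 < l.
Hypothesis s0 : s n @[n --> \oo] --> (0 : R).

Let L n (y : n.-tuple T) : R := \prod_(i < n) density P (Q n) (tnth y i).

Hypothesis Ls : forall n,
  (\int[iid P n]_y (Num.min 1 ((L y - l) ^+ 2))%:E <= (s n)%:E)%E.

Let mL n : measurable_fun setT (@L n).
Proof. by apply: measurable_prod_tnth; exact: measurable_density. Qed.

Let L0 n (y : n.-tuple T) : 0 <= L y.
Proof. by apply: prodr_ge0 => i _; exact: density_ge0. Qed.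

Let integral_iidQ n (phi : n.-tuple T -> \bar R) : measurable_fun setT phi ->
  (forall y, (0 <= phi y)%E) ->
  (\int[iid (Q n) n]_y phi y = \int[iid P n]_y (phi y * (L y)%:E))%E.
Proof.
apply: ge0_integral_iid_density.
- exact: measurable_density.
- exact: density_ge0.
- by move=> A; exact: densityE.
Qed.

Let L1 n : (\int[iid P n]_y (L y)%:E = 1)%E.
Proof.
have := @integral_iidQ n (cst 1%E) (measurable_cst _) (fun=> lee01).
rewrite integral_cst// mul1e [X in X = _]probability_setT => ->.
by apply: eq_integral => y _; rewrite mul1e.
Qed.

(** [a] is the slope of [phi] at infinity: the part [1 - l] of the unit mean of [L] escapes there
    and contributes [a * (1 - l)]. *)
Let cvgL (a : R) (phi : R -> R) : 0 <= a -> measurable_fun setT phi ->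
  (forall x, 0 <= phi x) -> {for l, continuous phi} ->
  (forall e : R, 0 < e -> exists K : R, forall x : R, 0 <= x ->
    `|phi x - a * x| <= K + e * x) ->
  (\int[iid P n]_y (phi (L y))%:E)%E @[n --> \oo] --> (phi l + a * (1 - l))%:E.
Proof.
move=> a0 mphi phi0 cphi asym.
exact: (@cvg_integral_comp R _ _ (fun n => iid P n) (fun n => @L n) s l a phi
  mL L0 L1 Ls s0 (ltW l0)).
Qed.

Let mlne : measurable_fun setT (fun x : R => lne x%:E).
Proof. exact: (measurableT_comp (@measurable_lne R) (@EFin_measurable _ setT)). Qed.

Lemma weakly_converges_null :
  weakly_converges
    (fun n => distribution (iid P n) (log_likelihood P (Q n) (n:=n)))
    \d_((ln l)%:E).
Proof.
apply: weakly_converges_nneg => F cF [C FC].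
have mF := continuous_ereal_measurable cF.
have mF' : measurable_fun setT (EFin \o F) by exact/measurable_EFinP.
have F0 x : 0 <= F x by have /andP[] := FC x.
rewrite integral_dirac// diracT mul1e.
rewrite [X in X @ _ --> _](_ : _ =
    fun n => (\int[iid P n]_y (F (lne (L y)%:E))%:E)%E); last first.
  apply/funext => n; rewrite ge0_integral_distribution//.
  by apply: eq_integral => y _; rewrite /= log_likelihoodE.
have := @cvgL 0 (fun x => F (lne x%:E)) (lexx _) (measurableT_comp mF mlne)
  (fun=> F0 _).
rewrite mul0r addr0 lne_EFin//; apply.
  exact: (continuous_comp (continuous_lne l0) (cF _)).
move=> e e0; exists C => x x0; rewrite mul0r subr0 ger0_norm//.
by have /andP[_ FxC] := FC (lne x%:E); rewrite (le_trans FxC)// lerDl mulr_ge0// ltW.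
Qed.

(** After the change of measure the integrand is [F (lne L) * L], whose slope at infinity is
    [F +oo]. The escaping mass thus becomes the atom at [+oo]. *)
Lemma weakly_converges_alternative : l <= 1 ->
  weakly_converges
    (fun n => distribution (iid (Q n) n) (log_likelihood P (Q n) (n:=n)))
    (mixture l \d_((ln l)%:E) \d_(+oo%E)).
Proof.
move=> l1; apply: weakly_converges_nneg => F cF [C FC].
have mF := continuous_ereal_measurable cF.
have mF' : measurable_fun setT (EFin \o F) by exact/measurable_EFinP.
have F0 x : 0 <= F x by have /andP[] := FC x.
have C0 : 0 <= C by have /andP[H1 H2] := FC +oo%E; exact: le_trans H2.
rewrite ge0_integral_mixture ?(ltW l0)//.
rewrite !integral_dirac// !diracT !mul1e -!EFinM -EFinD.
(* The maximum keeps [phi] nonnegative on the whole line and changes nothing at values of [L]. *)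
pose phi x := F (lne x%:E) * Num.max 0 x.
have max0 (x : R) : 0 <= Num.max 0 x by rewrite le_max lexx.
have mphi : measurable_fun setT phi.
  apply: measurable_funM; first exact: (measurableT_comp mF mlne).
  exact: measurable_maxr.
have phi0 x : 0 <= phi x by rewrite mulr_ge0.
rewrite [X in X @ _ --> _](_ : _ =
    fun n => (\int[iid P n]_y (phi (L y))%:E)%E); last first.
  apply/funext => n; rewrite ge0_integral_distribution//.
  transitivity (\int[iid (Q n) n]_y (F (lne (L y)%:E))%:E)%E.
    by apply: eq_integral => y _; rewrite /= log_likelihoodE.
  rewrite integral_iidQ//.
    by apply: eq_integral => y _; rewrite -EFinM /phi max_r.
    apply/measurable_EFinP.
    exact: (measurableT_comp (measurableT_comp mF mlne) (@mL n)).
  by move=> y; rewrite lee_fin.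
rewrite -(lne_EFin l0).
have -> : l * F (lne l%:E) + (1 - l) * F +oo%E = phi l + F +oo%E * (1 - l).
  by rewrite /phi max_r ?(ltW l0)//; ring.
apply: cvgL => //.
  apply: cvgM; first exact: (continuous_comp (continuous_lne l0) (cF _)).
  apply: (@continuous_max _ _ (cst 0) id); [exact: cvg_cst|exact: cvg_id].
move=> e e0.
have /cvgrPdist_le/(_ _ e0) := cF +oo%E.
move=> -[A [_ AF]].
(* Above [expR A] the logarithm exceeds [A], where [F] is within [e] of [F +oo]; below it the
   difference is at most [C] and [x] at most [expR A]. *)
exists (C * expR A) => x x0; rewrite /phi max_r// -mulrBl normrM (ger0_norm x0).
have [xA|xA] := ltP (expR A) x.
  have xp : 0 < x := lt_trans (expR_gt0 A) xA.
  rewrite (le_trans (y := e * x))//; last first.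
    by rewrite lerDr mulr_ge0// expR_ge0.
  rewrite ler_wpM2r// distrC; apply: AF.
  by rewrite lne_EFin// lte_fin -[ltLHS]expRK ltr_ln ?posrE ?expR_gt0.
rewrite (le_trans (y := C * expR A))//; last by rewrite lerDl mulr_ge0// ltW.
rewrite ler_pM//; have /andP[H1 H2] := FC (lne x%:E).
by have /andP[H3 H4] := FC +oo%E; rewrite ler_norml; apply/andP; split; lra.
Qed.

(** The sum of errors is the null expectation of [psi + (1 - psi) L], a convex combination of 1 and
    [L]. It lies between the means of [min(1, L)] and [max(1, L)], of slopes 0 and 1, which both
    tend to 1. *)
Lemma undetectable_iid : l = 1 ->
  undetectable (fun n => iid P n) (fun n => iid (Q n) n).
Proof.
move=> l1 psi psi01.
have mpsi n : measurable_fun setT (psi n) by exact: measurable_funP.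
have psi0 n y : 0 <= psi n y by have /andP[] := psi01 n y.
have psi1 n y : 0 <= 1 - psi n y by have /andP[] := psi01 n y; rewrite subr_ge0.
have mpsi' n : measurable_fun setT (fun y => 1 - psi n y).
  by apply: measurable_funB => //; exact: measurable_cst.
have mpsiL n : measurable_fun setT (fun y => (1 - psi n y) * L y).
  by apply: measurable_funM => //; exact: mL.
have bounds : \forall n \near \oo, (\int[iid P n]_y (Num.min 1 (L y))%:E <=
    'E_(iid P n)[psi n] + 'E_(iid (Q n) n)[fun y => (1 - psi n y)%R] <=
    \int[iid P n]_y (Num.max 1 (L y))%:E)%E.
  apply: nearW => n; rewrite unlock integral_iidQ//; last 2 first.
  - by apply/measurable_EFinP; exact: mpsi'.
  - by move=> y; rewrite lee_fin.
  rewrite -ge0_integralD//; last 4 first.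
  - by move=> y _; rewrite lee_fin.
  - by apply/measurable_EFinP; exact: mpsi.
  - by move=> y _; rewrite -EFinM lee_fin mulr_ge0.
  - by apply: emeasurable_funM; apply/measurable_EFinP; [exact: mpsi'|exact: mL].
  have ms : measurable_fun setT
      (fun y => ((psi n y)%:E + (1 - psi n y)%:E * (L y)%:E)%E).
    apply: emeasurable_funD; first by apply/measurable_EFinP; exact: mpsi.
    by apply: emeasurable_funM; apply/measurable_EFinP; [exact: mpsi'|exact: mL].
  apply/andP; split; apply: ge0_le_integral => //.
  - by move=> y _; rewrite lee_fin le_min ler01 L0.
  - by apply/measurable_EFinP; apply: measurable_minr => //; exact: mL.
  - move=> y _; rewrite -EFinM -EFinD lee_fin.
    have := psi0 n y; have := psi1 n y; have := L0 y.
    by have [h|h] := leP 1 (L y); nra.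
  - by move=> y _; rewrite -EFinM -EFinD lee_fin addr_ge0 ?mulr_ge0.
  - by apply/measurable_EFinP; apply: measurable_maxr => //; exact: mL.
  - move=> y _; rewrite -EFinM -EFinD lee_fin.
    have := psi0 n y; have := psi1 n y; have := L0 y.
    by have [h|h] := leP 1 (L y); nra.
apply: (squeeze_cvge bounds).
(* The absolute value gives nonnegativity at negative arguments too, as [cvgL] demands. *)
- have := @cvgL 0 (fun x => `|Num.min 1 x|).
  rewrite l1 mul0r addr0 min_l// normr1.
  rewrite (_ : (fun n => _) = (fun n => \int[iid P n]_y (Num.min 1 (L y))%:E)%E).
    apply => //.
    + by apply: measurableT_comp => //; exact: measurable_minr.
    + apply: (continuous_comp (f := fun x : R => Num.min 1 x)).
        by apply: (@continuous_min _ _ (cst 1) id); [exact: cvg_cst|exact: cvg_id].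
      exact: norm_continuous.
    + move=> e e0; exists 1 => x x0; rewrite mul0r subr0 normr_id.
      rewrite ger0_norm ?le_min ?ler01//.
      by rewrite (le_trans (y := 1)) ?ge_min ?lexx// lerDl mulr_ge0// ltW.
  apply/funext => n; apply: eq_integral => y _.
  by rewrite ger0_norm// le_min ler01 L0.
- have := @cvgL 1 (fun x => Num.max 1 x).
  rewrite l1 subrr mulr0 addr0 max_l//; apply => //.
  + exact: measurable_maxr.
  + by move=> x; rewrite le_max ler01.
  + by apply: (@continuous_max _ _ (cst 1) id); [exact: cvg_cst|exact: cvg_id].
  + move=> e e0; exists 1 => x x0; rewrite mul1r.
    have ex : 0 <= e * x by rewrite mulr_ge0// ltW.
    have [h|h] := leP 1 x; first by rewrite subrr normr0 addr_ge0.
    by rewrite ler_norml; apply/andP; split; lra.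
Qed.

End iid_likelihood.

(** * Specialization to the normal mixture *)

(** Ensures that the derivative inside [Tn] is a genuine density and not its default value. *)
Lemma Qn_dominates (R : realType) (sigma0 r : R) n : 0 < sigma0 ->
  charge_of_finite_measure (Qn sigma0 r n) `<< P0 R.
Proof.
move=> s0; apply/null_content_dominatesP => A mA A0.
rewrite -[LHS]/(mixture (eps R n) (mun sigma0 r n) (P0 R) A).
have munA : mun sigma0 r n A = 0%E.
  rewrite mun_density// null_set_integral//.
  apply: measurable_funTS; apply/measurable_EFinP.
  exact: measurable_normal_ratio.
by rewrite /mixture; case: ifP => // _; rewrite munA A0 !mule0 adde0.
Qed.

Lemma cvg_normal_likelihood_ratio (R : realType) (sigma0 r : R) :
  0 < sigma0 -> 0 < r ->
  exists2 s : R^nat, s n @[n --> \oo] --> (0 : R) & forall n,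
    (\int[iid (P0 R) n]_y (Num.min 1
      ((\prod_(i < n) density (P0 R) (Qn sigma0 r n) (tnth y i)
        - expR (light_mass r - 1)) ^+ 2))%:E <= (s n)%:E)%E.
Proof.
move=> s0 r0; have [t [tE t0 mup]] := cvg_mun_truncations s0 r0.
apply: (@cvg_likelihood_ratio _ _ _ (P0 R) (mun sigma0 r)
  (normal_ratio sigma0 r) (fun n => density (P0 R) (Qn sigma0 r n)) t) => //.
- by move=> n; exact: measurable_normal_ratio.
- by move=> n x; exact: normal_ratio_gt0.
- by move=> n A mA; exact: mun_density.
- by move=> n; apply: measurable_density; exact: Qn_dominates.
- by move=> n x; exact: density_ge0.
- by move=> n A mA; apply: densityE => //; exact: Qn_dominates.
Qed.

Theorem theorem4p10 (R : realType) (sigma0 r : R)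
    (sigma0_gt0 : 0 < sigma0) (r_gt0 : 0 < r) :
  [/\ r < 1 -> undetectable (prodP R) (prodQ sigma0 r),
      r = 1 ->
        weakly_converges (fun n => distribution (prodP R n) (Tn sigma0 r n))
          \d_((- 2^-1)%:E) /\
        weakly_converges (fun n => distribution (prodQ sigma0 r n) (Tn sigma0 r n))
          (mixture (expR (- 2^-1)) \d_((- 2^-1)%:E) \d_(+oo%E))
    & 1 < r ->
        weakly_converges (fun n => distribution (prodP R n) (Tn sigma0 r n))
          \d_((- 1)%:E) /\
        weakly_converges (fun n => distribution (prodQ sigma0 r n) (Tn sigma0 r n))
          (mixture (expR (- 1)) \d_((- 1)%:E) \d_(+oo%E))].
Proof.
have QP n := @Qn_dominates R sigma0 r n sigma0_gt0.
have [s s0 Ls] := cvg_normal_likelihood_ratio sigma0_gt0 r_gt0.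
have l0 := expR_gt0 (light_mass r - 1).
(* Covers [r = 1] and [r > 1] together: the finite atom is [ln l = p - 1], that is [-1/2] or
   [-1]. *)
have weak (c : R) : light_mass r - 1 = c -> c <= 0 ->
    weakly_converges (fun n => distribution (prodP R n) (Tn sigma0 r n))
      \d_(c%:E) /\
    weakly_converges (fun n => distribution (prodQ sigma0 r n) (Tn sigma0 r n))
      (mixture (expR c) \d_(c%:E) \d_(+oo%E)).
  move=> cE c0; rewrite cE in Ls l0.
  have l1 : expR c <= 1 by rewrite -expR0 ler_expR.
  have := weakly_converges_alternative QP l0 s0 Ls l1.
  have := weakly_converges_null QP l0 s0 Ls.
  by rewrite expRK.
split=> [r1|r1|r1].
- apply: (undetectable_iid QP l0 s0 Ls).
  by rewrite /light_mass r1 subrr expR0.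
- apply: weak; last lra.
  by rewrite /light_mass r1 ltxx eqxx; lra.
- apply: weak; last lra.
  by rewrite /light_mass ltNge ltW//= gt_eqF// sub0r.
Qed.
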